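(* Let $X$ be a Hilbert bimodule over a $C^*$-algebra $A$, let $(\psi,\pi)$ be the universal representation of $X$ generating the Toeplitz algebra $\mathcal{T}(X)$, let $\gamma:\mathbb{T}\to\operatorname{Aut}\mathcal{T}(X)$ be the gauge action, and define $\alpha:\mathbb{R}\to\operatorname{Aut}\mathcal{T}(X)$ by $\alpha_t=\gamma_{e^{it}}$. Suppose $\beta>0$ and $\phi$ is a state on $\mathcal{T}(X)$. Then $\phi$ is a KMS$_\beta$ state of $(\mathcal{T}(X),\alpha)$ if and only if $\phi\circ\pi$ is a trace on $A$ and, for all $l,m\in\mathbb{N}=\{0,1,2,\dots\}$, $x\in X^{\otimes l}$ and $y\in X^{\otimes m}$, $$\phi\big(\psi^{\otimes l}(x)\psi^{\otimes m}(y)^*\big)=\begin{cases}0&\text{if } m\neq l\\ e^{-\beta m}\,\phi\circ\pi(\langle y,x\rangle_A)&\text{if } m=l.\end{cases}$$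
   Context: A Hilbert bimodule over a $C^*$-algebra $A$ (also called a $C^*$-correspondence over $A$) is a right Hilbert $A$-module $X$ with a left action of $A$ given by a homomorphism $\varphi:A\to\mathcal{L}(X)$ into the adjointable operators. The $A$-valued inner product is conjugate linear in the first variable. $X^{\otimes m}$ is the $m$-fold internal tensor product $X\otimes_A\cdots\otimes_A X$, with $X^{\otimes 0}:=A$ (with inner product $\langle a,b\rangle=a^*b$). A representation $(\psi,\pi)$ of $X$ in a $C^*$-algebra $C$ is a linear map $\psi:X\to C$ and a homomorphism $\pi:A\to C$ with $\psi(a\cdot x\cdot b)=\pi(a)\psi(x)\pi(b)$ and $\pi(\langle x,y\rangle)=\psi(x)^*\psi(y)$. It induces representations $(\psi^{\otimes m},\pi)$ of $X^{\otimes m}$ with $\psi^{\otimes m}(x_1\otimes\cdots\otimes x_m)=\psi(x_1)\cdots\psi(x_m)$, and $\psi^{\otimes 0}:=\pi$. The Toeplitz algebra $\mathcal{T}(X)$ is the $C^*$-algebra generated by a universal representation, always denoted $(\psi,\pi)$; it is the closed linear span of the elements $\psi^{\otimes m}(x)\psi^{\otimes n}(y)^*$. The gauge action $\gamma$ of $\mathbb{T}$ on $\mathcal{T}(X)$ is characterised by $\gamma_z(\psi(x))=z\psi(x)$, $\gamma_z(\pi(a))=\pi(a)$. For an action $\alpha$ of $\mathbb{R}$ on a $C^*$-algebra $B$, $a\in B$ is analytic if $t\mapsto\alpha_t(a)$ extends to an entire function $z\mapsto\alpha_z(a)$ on $\mathbb{C}$. A state $\phi$ of $B$ is a KMS$_\beta$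 state of $(B,\alpha)$ if $\phi(ab)=\phi(b\,\alpha_{i\beta}(a))$ for all analytic $a,b$. (It suffices to check this for $a,b$ in a set of analytic elements spanning a dense subspace.) *)

(* Defs.v *)
From HB Require Import structures.
From mathcomp Require Import all_boot all_order all_algebra.
From mathcomp Require Import complex.
From mathcomp Require Import all_classical all_reals all_analysis.

Set Implicit Arguments.
Unset Strict Implicit.
Unset Printing Implicit Defensive.

Import Order.TTheory GRing.Theory Num.Theory.
Import numFieldNormedType.Exports.
Local Open Scope classical_set_scope.
Local Open Scope ring_scope.

(* Complex C*-algebras, not necessarily unital. The scalars are R[i], so the
   norm of the underlying Banach space takes (real) values in R[i]. *)
HB.mixin Record isCstarAlgebra (R : realType) B of CompleteNormedModule R[i] B := {
  cmul : B -> B -> B;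
  cstar : B -> B;
  cmulA : forall a b c, cmul a (cmul b c) = cmul (cmul a b) c;
  cmulPl : forall (k : R[i]) a b c,
    cmul (k *: a + b) c = k *: cmul a c + cmul b c;
  cmulPr : forall (k : R[i]) a b c,
    cmul c (k *: a + b) = k *: cmul c a + cmul c b;
  cstarP : forall (k : R[i]) a b, cstar (k *: a + b) = k^* *: cstar a + cstar b;
  cstarK : involutive cstar;
  cstarM : forall a b, cstar (cmul a b) = cmul (cstar b) (cstar a);
  cnormM : forall a b, `|cmul a b| <= `|a| * `|b|;
  cnormC : forall a, `|cmul (cstar a) a| = `|a| ^+ 2
}.

#[short(type="cstarAlgType")]
HB.structure Definition CstarAlgebra (R : realType) :=
  {B of CompleteNormedModule R[i] B & isCstarAlgebra R B}.

Notation "a ** b" := (cmul a b) (at level 40, left associativity).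

(* Right Hilbert modules; the inner product is linear in the second variable. *)
HB.mixin Record isHilbertModule (R : realType) (A : cstarAlgType R) X
    of CompleteNormedModule R[i] X := {
  ract : X -> A -> X;
  inner : X -> X -> A;
  ractM : forall x a b, ract x (a ** b) = ract (ract x a) b;
  ractPl : forall (k : R[i]) x y a,
    ract (k *: x + y) a = k *: ract x a + ract y a;
  ractPr : forall (k : R[i]) x a b,
    ract x (k *: a + b) = k *: ract x a + ract x b;
  innerPr : forall (k : R[i]) x y z,
    inner x (k *: y + z) = k *: inner x y + inner x z;
  inner_ract : forall x y a, inner x (ract y a) = inner x y ** a;
  inner_star : forall x y, cstar (inner x y) = inner y x;
  inner_ge0 : forall x, exists b : A, inner x x = cstar b ** b;
  inner_norm : forall x, `|x| ^+ 2 = `|inner x x|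
}.

#[short(type="hilbertModType")]
HB.structure Definition HilbertModule (R : realType) (A : cstarAlgType R) :=
  {X of CompleteNormedModule R[i] X & isHilbertModule R A X}.

(* Hilbert bimodules, i.e. C*-correspondences over A. By lact_adj each
   [lact a] is adjointable (hence a bounded A-linear map) with adjoint
   [lact (cstar a)], so the fields say that [lact] is a *-homomorphism from A
   to the adjointable operators. It need not be injective or nondegenerate. *)
HB.mixin Record isCorrespondence (R : realType) (A : cstarAlgType R) X
    of HilbertModule R A X := {
  lact : A -> X -> X;
  lactM : forall a b x, lact (a ** b) x = lact a (lact b x);
  lactP : forall (k : R[i]) a b x, lact (k *: a + b) x = k *: lact a x + lact b x;
  lact_adj : forall a (x y : X), inner (lact a x) y = inner x (lact (cstar a) y)
}.

#[short(type="corrType")]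
HB.structure Definition Correspondence (R : realType) (A : cstarAlgType R) :=
  {X of HilbertModule R A X & isCorrespondence R A X}.

(* A as a correspondence over itself, with <a, b> = a^* b. *)
Definition self_corr (R : realType) (A : cstarAlgType R) : Type := A.

Section SelfCorr.
Variables (R : realType) (A : cstarAlgType R).

HB.instance Definition _ := CompleteNormedModule.on (self_corr A).

Let self_ge0 (x : self_corr A) :
  exists b : A, cstar (x : A) ** x = cstar b ** b.
Proof. by exists x. Qed.

Let self_star (x y : self_corr A) :
  cstar (cstar (x : A) ** y) = cstar (y : A) ** x.
Proof. by rewrite cstarM cstarK. Qed.

Let self_norm (x : self_corr A) : `|x| ^+ 2 = `|cstar (x : A) ** x|.
Proof. by rewrite cnormC. Qed.

HB.instance Definition _ := @isHilbertModule.Build R A (self_corr A)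
  (fun (x : A) a => x ** a) (fun x y : A => cstar x ** y)
  (fun x a b => cmulA x a b) (fun k x y a => cmulPl k x y a)
  (fun k x a b => cmulPr k a b x) (fun k x y z => cmulPr k y z (cstar x))
  (fun x y a => cmulA (cstar x) y a) self_star self_ge0 self_norm.

Let self_adj (a : A) (x y : self_corr A) :
  inner (a ** x : self_corr A) y = inner x (cstar a ** y : self_corr A) :> A.
Proof. by rewrite /inner /= cstarM cmulA. Qed.

HB.instance Definition _ := @isCorrespondence.Build R A (self_corr A)
  (fun a (x : A) => a ** x) (fun a b x => esym (cmulA a b x))
  (fun k a b x => cmulPl k a b x) self_adj.

End SelfCorr.

Section Definitions.
Variable R : realType.

(* Z is the internal tensor product of X and Y, with elementary tensors t x y.
   This determines (Z, t) up to isomorphism. *)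
Record is_internal_tensor (A : cstarAlgType R) (X Y Z : corrType A)
    (t : X -> Y -> Z) : Prop := IsInternalTensor {
  tensorPl : forall (k : R[i]) x x' y, t (k *: x + x') y = k *: t x y + t x' y;
  tensorPr : forall (k : R[i]) x y y', t x (k *: y + y') = k *: t x y + t x y';
  tensor_balanced : forall x a y, t (ract x a) y = t x (lact a y);
  tensor_inner : forall x y x' y',
    inner (t x y) (t x' y') = inner y (lact (inner x x') y') :> A;
  tensor_ract : forall x y a, ract (t x y) a = t x (ract y a);
  tensor_lact : forall a x y, lact a (t x y) = t (lact a x) y;
  tensor_dense : dense [set z : Z | exists n (x : 'I_n -> X) (y : 'I_n -> Y),
                          z = \sum_i t (x i) (y i)]
}.

(* The tensor powers are A, X, X (x) X, X (x) (X (x) X), ... where Y k stands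
   for the (k+2)-nd one. The power 1 is X itself: since the left action may be
   degenerate, X (x) A is isomorphic to X but A (x) X need not be. *)
Definition tpow_of (A : cstarAlgType R) (X : corrType A)
    (Y : nat -> corrType A) (m : nat) : corrType A :=
  match m with 0 => self_corr A | 1 => X | k.+2 => Y k end.

Record tensor_powers (A : cstarAlgType R) (X : corrType A) := TensorPowers {
  tp_obj : nat -> corrType A;
  tp_tensor : forall k, X -> tpow_of X tp_obj k.+1 -> tp_obj k;
  tp_spec : forall k, is_internal_tensor (@tp_tensor k)
}.

Definition tpow (A : cstarAlgType R) (X : corrType A) (XX : tensor_powers X) :=
  tpow_of X (tp_obj XX).

Definition tcons (A : cstarAlgType R) (X : corrType A) (XX : tensor_powers X)
    (k : nat) (x : X) (xi : tpow XX k.+1) : tpow XX k.+2 := tp_tensor x xi.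

Definition is_star_hom (B C : cstarAlgType R) (f : {linear B -> C}) : Prop :=
  (forall a b, f (a ** b) = f a ** f b) /\ (forall a, f (cstar a) = cstar (f a)).

Record is_representation (A : cstarAlgType R) (X : corrType A)
    (C : cstarAlgType R) (psi : {linear X -> C}) (pi : {linear A -> C}) : Prop :=
  IsRepresentation {
  rep_hom : is_star_hom pi;
  rep_bimod : forall a x b, psi (ract (lact a x) b) = pi a ** psi x ** pi b;
  rep_inner : forall x y, pi (inner x y) = cstar (psi x) ** psi y
}.

(* Psi m is the representation of the m-th tensor power induced by (psi, pi);
   see induced_rep_pure for its values on x_1 (x) ... (x) x_m. *)
Record is_induced_rep (A : cstarAlgType R) (X : corrType A)
    (XX : tensor_powers X) (C : cstarAlgType R)
    (psi : {linear X -> C}) (pi : {linear A -> C})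
    (Psi : forall m, {linear tpow XX m -> C}) : Prop := IsInducedRep {
  induced_rep : forall m, is_representation (Psi m) pi;
  induced0 : forall a : A, Psi 0%N a = pi a;
  induced1 : forall x : X, Psi 1%N x = psi x;
  induced_tcons : forall k (x : X) (xi : tpow XX k.+1),
    Psi k.+2 (tcons x xi) = psi x ** Psi k.+1 xi
}.

Fixpoint pure (A : cstarAlgType R) (X : corrType A) (XX : tensor_powers X)
    (x : X) (s : seq X) : tpow XX (size s).+1 :=
  match s with [::] => x | y :: s' => tcons x (pure XX y s') end.

Fixpoint pure_prod (X : Type) (C : cstarAlgType R) (psi : X -> C)
    (x : X) (s : seq X) : C :=
  match s with [::] => psi x | y :: s' => psi x ** pure_prod psi y s' end.

Lemma induced_rep_pure (A : cstarAlgType R) (X : corrType A)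
    (XX : tensor_powers X) (C : cstarAlgType R)
    (psi : {linear X -> C}) (pi : {linear A -> C})
    (Psi : forall m, {linear tpow XX m -> C}) (x : X) (s : seq X) :
  is_induced_rep psi pi Psi ->
  Psi (size s).+1 (pure XX x s) = pure_prod psi x s.
Proof.
move=> h; elim: s x => [|y s IHs] x /=; first exact: (induced1 h).
by rewrite (induced_tcons h) IHs.
Qed.

Record is_star_subalgebra (B : cstarAlgType R) (D : set B) : Prop :=
  IsStarSubalgebra {
  subalg0 : D 0;
  subalgP : forall (k : R[i]) a b, D a -> D b -> D (k *: a + b);
  subalgM : forall a b, D a -> D b -> D (a ** b);
  subalg_star : forall a, D a -> D (cstar a)
}.

Definition generates (B : cstarAlgType R) (S : set B) : Prop :=
  forall D : set B, is_star_subalgebra D -> closed D -> S `<=` D -> D = setT.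

(* T is the Toeplitz algebra of X, with universal representation (psi, pi). *)
Record is_toeplitz (A : cstarAlgType R) (X : corrType A) (T : cstarAlgType R)
    (psi : {linear X -> T}) (pi : {linear A -> T}) : Prop := IsToeplitz {
  toeplitz_rep : is_representation psi pi;
  toeplitz_gen : generates (range psi `|` range pi);
  toeplitz_univ : forall (C : cstarAlgType R) (psi' : {linear X -> C})
      (pi' : {linear A -> C}), is_representation psi' pi' ->
    exists h : {linear T -> C},
      [/\ is_star_hom h, forall x, h (psi x) = psi' x
        & forall a, h (pi a) = pi' a]
}.

(* The circle is the set of z : R[i] with |z| = 1; the values of gamma
   elsewhere are irrelevant. Actions are strongly continuous. *)
Record is_circle_action (B : cstarAlgType R)
    (gamma : R[i] -> {linear B -> B}) : Prop := IsCircleAction {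
  circle_hom : forall z, `|z| = 1 -> is_star_hom (gamma z);
  circle_bij : forall z, `|z| = 1 -> bijective (gamma z);
  circle1 : forall a, gamma 1 a = a;
  circleM : forall z w, `|z| = 1 -> `|w| = 1 ->
    forall a, gamma (z * w) a = gamma z (gamma w a);
  circle_continuous : forall a,
    {within [set z : R[i]^o | `|z| = 1],
      continuous ((fun z => gamma z a) : R[i]^o -> B)}
}.

Record is_gauge_action (A : cstarAlgType R) (X : corrType A)
    (T : cstarAlgType R) (psi : {linear X -> T}) (pi : {linear A -> T})
    (gamma : R[i] -> {linear T -> T}) : Prop := IsGaugeAction {
  gauge_action : is_circle_action gamma;
  gauge_psi : forall z, `|z| = 1 -> forall x, gamma z (psi x) = z *: psi x;
  gauge_pi : forall z, `|z| = 1 -> forall a, gamma z (pi a) = pi a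
}.

Definition expi (t : R) : R[i] := (cos t +i* sin t)%C.

Definition gauge_dynamics (B : cstarAlgType R)
    (gamma : R[i] -> {linear B -> B}) (t : R) : {linear B -> B} :=
  gamma (expi t).

Definition entire (B : cstarAlgType R) (F : R[i] -> B) : Prop :=
  forall z : R[i], derivable (F : R[i]^o -> B) z 1.

Definition entire_extension (B : cstarAlgType R) (alpha : R -> {linear B -> B})
    (a : B) (F : R[i] -> B) : Prop :=
  entire F /\ forall t : R, F (t%:C)%C = alpha t a.

Definition analytic (B : cstarAlgType R) (alpha : R -> {linear B -> B})
    (a : B) : Prop :=
  exists F : R[i] -> B, entire_extension alpha a F.

Definition is_positive (B : cstarAlgType R) (f : {scalar B}) : Prop :=
  forall a : B, 0 <= f (cstar a ** a).

(* The norm of a state, i.e. its least bound, is 1. *)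
Record is_state (B : cstarAlgType R) (f : {scalar B}) : Prop := IsState {
  state_pos : is_positive f;
  state_bound : forall a : B, `|f a| <= `|a|;
  state_norm : forall c : R[i], (forall a : B, `|f a| <= c * `|a|) -> 1 <= c
}.

Definition is_trace (B : cstarAlgType R) (f : {scalar B}) : Prop :=
  is_positive f /\ forall a b : B, f (a ** b) = f (b ** a).

(* F plays the role of z |-> alpha_z(a), the entire extension being unique. *)
Definition is_KMS_state (B : cstarAlgType R) (alpha : R -> {linear B -> B})
    (beta : R) (f : {scalar B}) : Prop :=
  is_state f /\
  forall (a b : B) (F : R[i] -> B),
    entire_extension alpha a F -> analytic alpha b ->
    f (a ** b) = f (b ** F (0 +i* beta)%C).

End Definitions.

(* Main.v *)
(* A *-homomorphism of C*-algebras is contractive: self-adjoint elements of norm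
   < 1 are imaginary parts of (formal, when there is no unit) unitaries 1 - k + i h,
   and homomorphisms preserve the relation between k and h. Hence psi, pi and the
   gauge action are continuous, psi^m(x) has gauge degree m, and the KMS condition
   used twice gives the formula of the theorem.

   Conversely, the formula yields phi(ab) = exp(- beta k) phi(ba) for every b
   when a is a generator of degree k = 1, 0 or -1, and this relation is
   multiplicative in a, so it holds for all monomials. For an arbitrary
   analytic a with entire extension F, compare P(x) = phi(gamma_x(a) b) with
   Q(w) = phi(b F(w)): approximating a by sums of monomials shows that the k-th
   Fourier coefficient of P is exp(k beta) times that of Q on the real line, which by
   Cauchy's theorem (for merely differentiable functions, so by Goursat's
   bisection) is the k-th coefficient of Q on the line of height beta. Fourier
   uniqueness gives P(0) = Q(i beta). *)
Require Import Defs.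
From HB Require Import structures.
From mathcomp Require Import all_boot all_order all_algebra.
From mathcomp Require Import complex.
From mathcomp Require Import all_classical all_reals all_analysis.
From mathcomp Require Import ring lra.
Set Implicit Arguments.
Unset Strict Implicit.
Unset Printing Implicit Defensive.
Import Order.TTheory GRing.Theory Num.Theory.
Import numFieldNormedType.Exports.
Local Open Scope classical_set_scope.
Local Open Scope ring_scope.

(** The KMS condition is stated for every analytic $a$, and the extension $F$ does not depend
    continuously on $a$: approximating $a$ by sums of monomials says nothing about $F(i\beta)$.
    Fourier coefficients of the real orbit are continuous in $a$, and those of $a$ itself can be
    moved to height $\beta$ because $F$ exists; hence the detour. The shift needs $Q$ to be
    $2\pi$-periodic off the real line too. Periodicity spreads from the real line by the identity
    theorem, which is derived here from Fourier uniqueness instead of power series.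

    On the algebraic side $A$ may lack a unit, and a representation is given by the two-sided
    relation $\psi(axb)=\pi(a)\psi(x)\pi(b)$. The relation $\psi(ax)=\pi(a)\psi(x)$ and the fact
    that $\psi^{\otimes m}(u)$ is itself a limit of monomials come from approximate units, built
    from square roots. Products such as $\psi(x)^*\psi^{\otimes m}(u)$ are computed on elementary
    tensors and land in closures of ranges, so statements about monomials have to be carried to such
    closures. *)

(* Identities in abelian groups are decided by comparing integer coefficients. *)
Inductive zexpr := ZVar of nat | ZZero | ZAdd of zexpr & zexpr | ZOpp of zexpr.

Fixpoint zeval (V : zmodType) (s : seq V) (e : zexpr) : V :=
  match e with
  | ZVar i => s`_i | ZZero => 0
  | ZAdd e1 e2 => zeval s e1 + zeval s e2 | ZOpp e1 => - zeval s e1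
  end.

Fixpoint zcoef (e : zexpr) (i : nat) : int :=
  match e with
  | ZVar j => (i == j)%:Z | ZZero => 0
  | ZAdd e1 e2 => zcoef e1 i + zcoef e2 i | ZOpp e1 => - zcoef e1 i
  end.

Lemma zevalE (V : zmodType) (s : seq V) e :
  zeval s e = \sum_(i < size s) s`_i *~ zcoef e i.
Proof.
elim: e => [j||e1 IH1 e2 IH2|e1 IH1] /=; rewrite ?IH1 ?IH2.
- have [js|sj] := ltnP j (size s).
    rewrite (bigD1 (Ordinal js)) //= eqxx mulr1z big1 ?addr0 // => i ij.
    by rewrite (_ : (i : nat) == j = false) ?mulr0z //; apply/negbTE.
  rewrite nth_default // big1 // => i _.
  by rewrite (_ : (i : nat) == j = false) ?mulr0z // ltn_eqF // (leq_trans (ltn_ord i)).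
- by rewrite big1.
- by rewrite -big_split; apply: eq_bigr => i _; rewrite mulrzDr.
- by rewrite -sumrN; apply: eq_bigr => i _; rewrite mulrNz.
Qed.

Lemma zexpr_eq (V : zmodType) (s : seq V) e1 e2 :
  all (fun i => zcoef e1 i == zcoef e2 i) (iota 0 (size s)) ->
  zeval s e1 = zeval s e2.
Proof.
move=> /allP h; rewrite !zevalE; apply: eq_bigr => i _; congr (_ *~ _).
by apply/eqP/h; rewrite mem_iota /=.
Qed.

Ltac zfind x s :=
  match s with
  | x :: _ => constr:(0%N)
  | _ :: ?s' => let n := zfind x s' in constr:(n.+1)
  end.
Ltac zatoms t s :=
  match t with
  | (?a + ?b)%R => let s1 := zatoms a s in zatoms b s1
  | (- ?a)%R => zatoms a s
  | 0%R => s
  | _ => match s with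
         | _ => let n := zfind t s in s
         | _ => constr:(t :: s)
         end
  end.
Ltac zreify t s :=
  match t with
  | (?a + ?b)%R => let x := zreify a s in let y := zreify b s in constr:(ZAdd x y)
  | (- ?a)%R => let x := zreify a s in constr:(ZOpp x)
  | 0%R => constr:(ZZero)
  | _ => let n := zfind t s in constr:(ZVar n)
  end.
Ltac zmod :=
  match goal with |- ?l = ?r :> ?T =>
    let s0 := zatoms l (@nil T) in let s := zatoms r s0 in
    let el := zreify l s in let er := zreify r s in
    exact: (@zexpr_eq _ s el er isT)
  end.

(** * C*-algebras *)

Section RealNorm.
Variable R : realType.

Definition nm (V : normedZmodType R[i]) (v : V) : R := complex.Re `|v|.

Section Zmod.
Variable V : normedZmodType R[i].
Implicit Types u v : V.

Lemma nmE v : `|v| = ((nm v)%:C)%C.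
Proof. by rewrite /nm RRe_real // ger0_real. Qed.

Lemma nm_ge0 v : 0 <= nm v.
Proof. by rewrite -ler0c -nmE. Qed.

Lemma nm0 : nm (0 : V) = 0.
Proof. by rewrite /nm normr0. Qed.

Lemma nm0_eq0 v : nm v = 0 -> v = 0.
Proof. by move=> h; apply/normr0_eq0; rewrite nmE h. Qed.

Lemma nmD u v : nm (u + v) <= nm u + nm v.
Proof.
by rewrite -lecR rmorphD /= -!nmE ler_normD.
Qed.

Lemma nmN v : nm (- v) = nm v.
Proof. by rewrite /nm normrN. Qed.

Lemma nmB u v : nm (u - v) <= nm u + nm v.
Proof. by rewrite -(nmN v) nmD. Qed.

Lemma nm_distC u v : nm (u - v) = nm (v - u).
Proof. by rewrite -nmN opprB. Qed.

Lemma nm_dist w u v : nm (u - v) <= nm (u - w) + nm (w - v).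
Proof. by rewrite -[u - v](subrKA w) nmD. Qed.

Lemma nm_small0 v : (forall e, 0 < e -> nm v <= e) -> v = 0.
Proof.
move=> h; apply: nm0_eq0; apply/eqP; rewrite eq_le nm_ge0 andbT.
by rewrite leNgt; apply/negP => v0; have := h (nm v / 2) (divr_gt0 v0 (ltr0n _ 2)); lra.
Qed.

End Zmod.

Lemma nmZ (V : normedModType R[i]) (k : R[i]) (v : V) :
  nm (k *: v) = nm k * nm v.
Proof. by apply: (@complexI R); rewrite rmorphM /= -!nmE normrZ. Qed.

Lemma nmM (a b : R[i]) : nm (a * b) = nm a * nm b.
Proof. by apply: (@complexI R); rewrite rmorphM /= -!nmE normrM. Qed.

Lemma nmR (r : R) : nm ((r%:C)%C : R[i]) = `|r|.
Proof. by apply: (@complexI R); rewrite -nmE normc_def /= expr0n addr0 sqrtr_sqr. Qed.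

Lemma nmZR (V : normedModType R[i]) (r : R) (v : V) :
  nm ((r%:C)%C *: v) = `|r| * nm v.
Proof. by rewrite nmZ nmR. Qed.

Lemma nmi : nm ('i%C : R[i]) = 1.
Proof. by apply: (@complexI R); rewrite -nmE normc_def /= expr0n add0r expr1n sqrtr1. Qed.

Lemma conjcE (k : R[i]) : k^* = (k^*)%C. Proof. by []. Qed.

Lemma ballE (V : normedModType R[i]) (x y : V) (e : R) :
  ball x (e%:C)%C y <-> nm (x - y) < e.
Proof. by rewrite -ball_normE /= nmE ltcR. Qed.

Lemma posC (e : R[i]) : 0 < e -> exists2 r : R, 0 < r & e = (r%:C)%C.
Proof.
move=> e0; exists (complex.Re e); last by rewrite RRe_real // gtr0_real.
by move: e0; rewrite ltcE => /andP[_ ].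
Qed.

(** Closedness with a real epsilon, for predicates: density arguments become one application, with
    [E] an equation between bounded maps. *)
Definition lim_closed (V : normedZmodType R[i]) (E : V -> Prop) :=
  forall v, (forall e : R, 0 < e -> exists2 d, E d & nm (v - d) < e) -> E v.

Lemma lim_closed_closed (V : normedModType R[i]) (E : set V) :
  lim_closed E -> closed E.
Proof.
move=> h x xE; apply: h => e e0.
have : nbhs x (ball x ((e%:C)%C : R[i])) by apply: nbhsx_ballx; rewrite ltcR.
by move/xE => [d [Ed /ballE db]]; exists d.
Qed.

Lemma dense_approx (V : normedModType R[i]) (E : set V) :
  dense E -> forall v (e : R), 0 < e -> exists2 d, E d & nm (v - d) < e.
Proof.
move=> dE v e e0.
have e0' : 0 < (e%:C)%C :> R[i] by rewrite ltcR.
have [|d [/ballE db Ed]] := dE (ball v ((e%:C)%C : R[i])) _ (ball_open v _).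
  by exists v; exact: ballxx.
by exists d.
Qed.

(** Additive and not linear, so that the conjugate-linear [cstar] is covered. *)
Definition bounded_additive (V W : normedZmodType R[i]) (f : V -> W) :=
  (forall u v, f (u - v) = f u - f v) /\ exists C, forall v, nm (f v) <= C * nm v.

Lemma bounded_pos (V W : normedZmodType R[i]) (f : V -> W) :
  bounded_additive f ->
  exists2 C, 0 < C & forall v, nm (f v) <= C * nm v.
Proof.
move=> [_ [C hC]]; exists (`|C| + 1); first by rewrite ltr_wpDl.
move=> v; apply: (le_trans (hC v)); apply: ler_wpM2r; first exact: nm_ge0.
by rewrite (le_trans (ler_norm C)) // lerDl.
Qed.

Lemma bounded_sub (V W : normedZmodType R[i]) (f g : V -> W) :
  bounded_additive f -> bounded_additive g -> bounded_additive (fun v => f v - g v).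
Proof.
move=> [fD [C hC]] [gD [C' hC']]; split.
  by move=> u v; rewrite fD gD !opprD !opprK addrACA.
by exists (C + C') => v; rewrite (le_trans (nmB _ _)) // mulrDl lerD.
Qed.

Lemma bounded_comp (U V W : normedZmodType R[i]) (f : V -> W) (g : U -> V) :
  bounded_additive f -> bounded_additive g -> bounded_additive (fun v => f (g v)).
Proof.
move=> bf; have [C C0 hC] := bounded_pos bf; move: bf => [fD _] [gD [C' hC']]; split.
  by move=> u v; rewrite gD fD.
by exists (C * C') => v; rewrite (le_trans (hC _)) // -mulrA ler_pM2l.
Qed.

Lemma bounded_id (V : normedZmodType R[i]) : bounded_additive (fun v : V => v).
Proof. by split=> //; exists 1 => v; rewrite mul1r. Qed.

Lemma bounded_scale (V : normedModType R[i]) (W : normedZmodType R[i]) k (f : W -> V) :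
  bounded_additive f -> bounded_additive (fun v => k *: f v).
Proof.
move=> [fD [C hC]]; split; first by move=> u v; rewrite fD scalerBr.
by exists (nm k * C) => v; rewrite nmZ -mulrA ler_wpM2l // nm_ge0.
Qed.

Lemma lim_closed_preim (V W : normedZmodType R[i]) (f : V -> W) (E : W -> Prop) :
  bounded_additive f -> lim_closed E -> lim_closed (fun v => E (f v)).
Proof.
move=> bf hE v hv; have [C C0 hC] := bounded_pos bf; case: bf => fD _.
apply: hE => e e0.
have [d Ed dv] := hv (e / C) (divr_gt0 e0 C0).
exists (f d) => //; rewrite -fD (le_lt_trans (hC _)) // mulrC -ltr_pdivlMr //.
Qed.

Lemma lim_closed0 (V : normedZmodType R[i]) : lim_closed (fun v : V => v = 0).
Proof.
by move=> v hv; apply: nm_small0 => e /hv[d -> /ltW]; rewrite subr0.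
Qed.

Lemma lim_closed_eq (V W : normedZmodType R[i]) (f g : V -> W) :
  bounded_additive f -> bounded_additive g -> lim_closed (fun v => f v = g v).
Proof.
move=> bf bg v hv; apply/eqP; rewrite -subr_eq0; apply/eqP.
apply: (lim_closed_preim (bounded_sub bf bg) (@lim_closed0 W)) => e e0.
by have [d fg dv] := hv e e0; exists d => //; rewrite fg subrr.
Qed.

Lemma lim_closed_forall (V : normedZmodType R[i]) (I : Type) (E : I -> V -> Prop) :
  (forall i, lim_closed (E i)) -> lim_closed (fun v => forall i, E i v).
Proof.
by move=> h v hv i; apply: h => e /hv[d Ed dv]; exists d.
Qed.

Lemma geometric_small (C q e : R) : 0 <= q -> q < 1 -> 0 < e ->
  exists N, forall n, (N <= n)%N -> C * q ^+ n < e.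
Proof.
move=> q0 q1 e0.
have : geometric C q @ \oo --> (0 : R) by apply: cvg_geometric; rewrite ger0_norm.
move/cvgrPdist_lt => /(_ e e0) [N _ hN]; exists N => n /hN /=.
by rewrite /geometric /= sub0r normrN; apply: le_lt_trans; rewrite ler_norm.
Qed.

Lemma geometric_limit (V : completeNormedModType R[i]) (u : nat -> V) (C q : R) :
  0 <= q -> q < 1 -> (forall n, nm (u n.+1 - u n) <= C * q ^+ n) ->
  exists l, forall e, 0 < e -> exists N, forall n, (N <= n)%N -> nm (l - u n) < e.
Proof.
move=> q0 q1 hu.
have C0 : 0 <= C by apply: le_trans (nm_ge0 _) (le_trans (hu 0%N) _); rewrite expr0 mulr1.
(* The factor $1-q^k$ turns the bound into the exact partial geometric sum, which the induction on
   $k$ needs. *)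
have tail n k : nm (u (n + k)%N - u n) <= C / (1 - q) * q ^+ n * (1 - q ^+ k).
  elim: k => [|k IHk]; first by rewrite addn0 subrr nm0 expr0 subrr mulr0.
  rewrite addnS (le_trans (nm_dist (u (n + k)%N) _ _)) //.
  apply: (le_trans (lerD (hu _) IHk)); rewrite exprD exprS le_eqVlt; apply/orP; left.
  by apply/eqP; field; lra.
have q1' : 0 < 1 - q by lra.
have tail2 n k : (n <= k)%N -> nm (u k - u n) <= C / (1 - q) * q ^+ n.
  move=> /subnKC <-; apply: (le_trans (tail _ _)); rewrite ler_piMr //.
    by rewrite !mulr_ge0 ?invr_ge0 ?exprn_ge0 // ltW.
  by rewrite gerBl exprn_ge0.
have cu : cvg (u @ \oo).
  apply/cauchy_cvgP/cauchy_exP => _ /posC[e e0 ->].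
  have [N hN] := geometric_small (C / (1 - q)) q0 q1 e0.
  exists (u N), N => // n /= Nn; apply/ballE.
  by rewrite nm_distC (le_lt_trans (tail2 _ _ Nn)) // hN.
exists (lim (u @ \oo)) => e e0.
have e0' : 0 < (e%:C)%C :> R[i] by rewrite ltcR.
move/cvgrPdist_lt : cu => /(_ _ e0') [N _ hN]; exists N => n /hN /=.
by rewrite nmE ltcR.
Qed.

End RealNorm.

(** * Elementary C*-algebra, square roots and contractivity of homomorphisms *)

Section CstarBasics.
Variables (R : realType) (A : cstarAlgType R).
Implicit Types a b c w : A.

Lemma cmulDl a b c : (a + b) ** c = a ** c + b ** c.
Proof. by have := cmulPl (1 : R[i]) a b c; rewrite !scale1r. Qed.
Lemma cmulDr a b c : c ** (a + b) = c ** a + c ** b.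
Proof. by have := cmulPr (1 : R[i]) a b c; rewrite !scale1r. Qed.
Lemma cmul0l c : (0 : A) ** c = 0.
Proof. by apply: (addrI (0 ** c)); rewrite -cmulDl !addr0. Qed.
Lemma cmul0r c : c ** (0 : A) = 0.
Proof. by apply: (addrI (c ** 0)); rewrite -cmulDr !addr0. Qed.
Lemma cmulZl (k : R[i]) a c : (k *: a) ** c = k *: (a ** c).
Proof. by have := cmulPl k a 0 c; rewrite cmul0l !addr0. Qed.
Lemma cmulZr (k : R[i]) a c : c ** (k *: a) = k *: (c ** a).
Proof. by have := cmulPr k a 0 c; rewrite cmul0r !addr0. Qed.
Lemma cmulNl a c : (- a) ** c = - (a ** c).
Proof. by rewrite -scaleN1r cmulZl scaleN1r. Qed.
Lemma cmulNr a c : c ** (- a) = - (c ** a).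
Proof. by rewrite -scaleN1r cmulZr scaleN1r. Qed.
Lemma cmulBl a b c : (a - b) ** c = a ** c - b ** c.
Proof. by rewrite cmulDl cmulNl. Qed.
Lemma cmulBr a b c : c ** (a - b) = c ** a - c ** b.
Proof. by rewrite cmulDr cmulNr. Qed.
Lemma cstarD a b : cstar (a + b) = cstar a + cstar b.
Proof. by have := cstarP (1 : R[i]) a b; rewrite conjcE conjc1 !scale1r. Qed.
Lemma cstar0 : cstar (0 : A) = 0.
Proof. by apply: (addrI (cstar 0)); rewrite -cstarD !addr0. Qed.
Lemma cstarZ (k : R[i]) a : cstar (k *: a) = (k^*)%C *: cstar a.
Proof. by have := cstarP k a 0; rewrite cstar0 !addr0. Qed.
Lemma cstarN a : cstar (- a) = - cstar a.
Proof.
have e : ((- 1)^*)%C = - 1 :> R[i] by rewrite rmorphN /= oppr0.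
by rewrite -scaleN1r cstarZ e scaleN1r.
Qed.
Lemma cstarB a b : cstar (a - b) = cstar a - cstar b.
Proof. by rewrite cstarD cstarN. Qed.

Lemma nm_cmul a b : nm (a ** b) <= nm a * nm b.
Proof. by rewrite -lecR rmorphM /= -!nmE cnormM. Qed.

Lemma nm_cstar_mul a : nm (cstar a ** a) = nm a ^+ 2.
Proof. by apply: (@complexI R); rewrite rmorphXn /= -!nmE cnormC. Qed.

Lemma nm_cstar a : nm (cstar a) = nm a.
Proof.
have le b : nm b <= nm (cstar b).
  have [->|b0] := eqVneq (nm b) 0; first exact: nm_ge0.
  have b1 : 0 < nm b by rewrite lt_neqAle eq_sym b0 nm_ge0.
  by rewrite -(ler_pM2r b1) -expr2 -nm_cstar_mul nm_cmul.
by apply/eqP; rewrite eq_le -{2}(cstarK a) !le.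
Qed.

Lemma cstar_mul_eq0 a : cstar a ** a = 0 -> a = 0.
Proof.
move=> h; apply: nm0_eq0; apply/eqP; rewrite -sqrf_eq0 -nm_cstar_mul h.
by rewrite nm0.
Qed.

Lemma bounded_cmull a : bounded_additive (fun b => a ** b).
Proof. by split; [move=> u v; rewrite cmulBr | exists (nm a) => v; exact: nm_cmul]. Qed.

Lemma bounded_cmulr a : bounded_additive (fun b => b ** a).
Proof.
split; [by move=> u v; rewrite cmulBl|].
by exists (nm a) => v; rewrite mulrC; exact: nm_cmul.
Qed.

Lemma bounded_cstar : bounded_additive (fun b : A => cstar b).
Proof. by split; [exact: cstarB | exists 1 => v; rewrite mul1r nm_cstar]. Qed.

(* K + i H and K - i H are isometric, and K and H are their real and imaginary parts. *)
Lemma circle_contraction (K H : A -> A) :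
  (forall u v, cstar (K u) ** v = cstar u ** K v) ->
  (forall u v, cstar (H u) ** v = cstar u ** H v) ->
  (forall u, K (H u) = H (K u)) -> (forall u, K (K u) + H (H u) = u) ->
  forall u, nm (K u) <= nm u /\ nm (H u) <= nm u.
Proof.
move=> Kadj Hadj KH KKHH u.
pose P (s : R[i]) := K u + s *: H u.
have iso (s : R[i]) : (s^* )%C = - s -> s * s = -1 -> nm (P s) = nm u.
  move=> sc ss; apply/eqP; rewrite -(@eqrXn2 _ 2) ?nm_ge0 // -!nm_cstar_mul.
  rewrite /P cstarD cstarZ sc cmulDl !cmulDr !cmulZl !cmulZr scalerA mulNr ss opprK.
  rewrite scale1r !Kadj !Hadj KH scaleNr.
  have -> : cstar u ** u = cstar u ** K (K u) + cstar u ** H (H u).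
    by rewrite -cmulDr KKHH.
  by rewrite addrA addrK.
have h1 : nm (P 'i%C) = nm u.
  by apply: iso; [simpc | rewrite -expr2 sqr_i].
have h2 : nm (P (- 'i%C)) = nm u.
  apply: iso; last by rewrite mulrNN -expr2 sqr_i.
  by apply/eqP; rewrite eq_complex /= !opprK oppr0 !eqxx.
have two (r : A) : nm (r + r) = 2 * nm r.
  rewrite -mulr2n -scaler_nat nmZ /nm normr_nat.
  by rewrite -[X in X * _]/(complex.Re (2%:R)) -(rmorph_nat (real_complex R)).
have e1 : P 'i%C + P (- 'i%C) = K u + K u.
  by rewrite /P scaleNr addrACA subrr addr0.
have e2 : P 'i%C - P (- 'i%C) = 'i%C *: (H u + H u).
  by rewrite /P scaleNr opprD opprK addrACA subrr add0r scalerDr.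
split.
  by have := nmD (P 'i%C) (P (- 'i%C)); rewrite e1 two h1 h2; lra.
by have := nmB (P 'i%C) (P (- 'i%C)); rewrite e2 nmZ nmi mul1r two h1 h2; lra.
Qed.

(** The last hypothesis says $(1-k)^2+h^2=1$. Without a unit, $1-k$ exists only as the operator
    $w\mapsto w-kw$, so the circle relation is applied to left multiplications. *)
Lemma circle_elements k h : cstar k = k -> cstar h = h -> k ** h = h ** k ->
  k + k - k ** k = h ** h ->
  forall w, nm (w - k ** w) <= nm w /\ nm (h ** w) <= nm w.
Proof.
move=> ks hs kh kkhh w.
apply: (@circle_contraction (fun w => w - k ** w) (fun w => h ** w)).
- by move=> u v; rewrite cstarB cstarM ks cmulBl cmulBr cmulA.
- by move=> u v; rewrite cstarM hs cmulA.
- by move=> u; rewrite cmulBr !cmulA kh.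
- by move=> u; rewrite !cmulA -kkhh cmulBr cmulBl cmulA cmulDl; zmod.
Qed.

(* k = 1 - sqrt (1 - H) is the limit of the iteration k <- (H + k^2) / 2. *)
Lemma sqrt_complement (H : A) : cstar H = H -> nm H < 1 ->
  exists k, [/\ cstar k = k, k + k - k ** k = H &
    forall z : A, z ** H = H ** z -> z ** k = k ** z].
Proof.
move=> Hs H1.
have half : nm (2^-1 : R[i]) = 2^-1.
  by rewrite -(rmorph_nat (real_complex R)) -fmorphV nmR ger0_norm // invr_ge0.
pose f k := (2^-1 : R[i]) *: (H + k ** k).
pose u n := iter n f 0.
have us n : cstar (u n) = u n.
  elim: n => [|n IHn]; first exact: cstar0.
  rewrite /u iterS -/(u n) /f cstarZ cstarD Hs cstarM IHn.
  by rewrite conjc_inv conjc_nat.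
have uz z n : z ** H = H ** z -> z ** u n = u n ** z.
  move=> zH; elim: n => [|n IHn]; first by rewrite cmul0l cmul0r.
  by rewrite /u iterS -/(u n) /f cmulZr cmulZl cmulDr cmulDl zH cmulA IHn -!cmulA IHn.
have ub n : nm (u n) <= nm H.
  elim: n => [|n IHn]; first by rewrite nm0 nm_ge0.
  rewrite /u iterS -/(u n) /f nmZ half.
  have := nmD H (u n ** u n); have := nm_cmul (u n) (u n).
  have : nm (u n) * nm (u n) <= nm H * 1.
    by apply: ler_pM; rewrite ?nm_ge0 // (le_trans IHn) // ltW.
  by lra.
(* On the ball of radius [nm H], which contains all iterates, [f] contracts by the ratio [nm H]. *)
have ud n : nm (u n.+1 - u n) <= 1 * nm H ^+ n.
  elim: n => [|n IHn]; rewrite mul1r.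
    by rewrite subr0 expr0 (le_trans (ub 1%N)) // ltW.
  have -> : u n.+2 - u n.+1 = (2^-1 : R[i]) *:
     (u n.+1 ** (u n.+1 - u n) + (u n.+1 - u n) ** u n).
    transitivity ((2^-1 : R[i]) *: (H + u n.+1 ** u n.+1)
      - (2^-1 : R[i]) *: (H + u n ** u n)); first by [].
    by rewrite -scalerBr cmulBr cmulBl; congr (_ *: _); zmod.
  rewrite nmZ half mul1r in IHn *.
  set d := u n.+1 - u n in IHn *.
  have := nmD (u n.+1 ** d) (d ** u n).
  have := le_trans (nm_cmul (u n.+1) d) (ler_pM (nm_ge0 _) (nm_ge0 _) (ub _) IHn).
  have := le_trans (nm_cmul d (u n)) (ler_pM (nm_ge0 _) (nm_ge0 _) IHn (ub _)).
  by rewrite exprS; lra.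
have [k hk] := geometric_limit (nm_ge0 H) H1 ud.
have lc (E : A -> Prop) : lim_closed E -> (forall n, E (u n)) -> E k.
  move=> cE Eu; apply: cE => e /hk[N hN].
  by exists (u N) => //; exact: hN.
exists k; split.
- apply: (lc (fun k => cstar k = k)) => // {k hk lc}.
  exact: lim_closed_eq bounded_cstar (bounded_id A).
- have kb : nm k <= nm H.
    apply/ler_addgt0Pr => e /hk[N /(_ N (leqnn _))].
    have := ub N; have := nmD (k - u N) (u N); rewrite subrK; lra.
  apply/eqP; rewrite -subr_eq0; apply/eqP; apply: nm_small0 => e e0.
  have e4 : 0 < e / 4 by lra.
  have [N hN] := hk _ e4.
  have d1 := hN N (leqnn N); have d2 := hN N.+1 (leqnSn N).
  have eH : H = u N.+1 + u N.+1 - u N ** u N.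
    rewrite {1 2}/u iterS -/(u N) /f -scalerDl.
    have -> : 2^-1 + 2^-1 = 1 :> R[i] by field.
    by rewrite scale1r addrK.
  have -> : k + k - k ** k - H = (k - u N.+1) + (k - u N.+1)
     - (k ** (k - u N) + (k - u N) ** u N).
    by rewrite {1}eH cmulBr cmulBl; zmod.
  set d := k - u N in d1 *; set d' := k - u N.+1 in d2 *.
  have := nmB (d' + d') (k ** d + d ** u N); have := nmD d' d'.
  have := nmD (k ** d) (d ** u N).
  have := le_trans (nm_cmul k d) (ler_pM (nm_ge0 _) (nm_ge0 _) kb (ltW d1)).
  have := le_trans (nm_cmul d (u N)) (ler_pM (nm_ge0 _) (nm_ge0 _) (ltW d1) (ub N)).
  have : nm H * (e / 4) <= 1 * (e / 4) by apply: ler_wpM2r; lra.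
  by lra.
- move=> z zH; apply: (lc (fun k => z ** k = k ** z)) => [|n]; last exact: uz.
  exact: lim_closed_eq (bounded_cmull z) (bounded_cmulr z).
Qed.

End CstarBasics.

(* A self-adjoint h with |h| < 1 is the imaginary part of the unitary
   sqrt (1 - h^2) + i h, and f preserves this relation. *)
Lemma star_hom_contraction (R : realType) (A B : cstarAlgType R)
    (f : {linear A -> B}) : is_star_hom f -> forall a, nm (f a) <= nm a.
Proof.
move=> [fM fs] a.
have unit_ball h : cstar h = h -> nm h < 1 -> nm (f h) <= 1.
  move=> hs h1.
  have hh1 : nm (h ** h) < 1.
    by rewrite -{1}hs nm_cstar_mul expr_lt1 // nm_ge0.
  have [|k [ks kk kz]] := sqrt_complement _ hh1; first by rewrite cstarM hs.
  have kh : h ** k = k ** h by apply: kz; rewrite cmulA.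
  (* Evaluating at $w=f(h)$ gives $|f(h)|^2\le|f(h)|$. *)
  have [||||_ +] := @circle_elements _ _ (f k) (f h) _ _ _ _ (f h).
  - by rewrite -fs ks.
  - by rewrite -fs hs.
  - by rewrite -!fM kh.
  - by rewrite -!fM -linearD -linearB kk.
  rewrite -{1}hs fs nm_cstar_mul expr2.
  have [->|n0] := eqVneq (nm (f h)) 0; first by rewrite ler01.
  by rewrite -{3}[nm (f h)]mul1r ler_pM2r // lt_neqAle eq_sym n0 nm_ge0.
have self_adj h : cstar h = h -> nm (f h) <= nm h.
  move=> hs; apply/ler_addgt0Pr => e e0.
  have n0 : 0 < nm h + e by rewrite ltr_wpDl // nm_ge0.
  have := unit_ball ((((nm h + e)^-1)%:C)%C *: h).
  rewrite cstarZ hs conjc_real => /(_ erefl).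
  rewrite linearZ /= !nmZR gtr0_norm ?invr_gt0 // ![_^-1 * _]mulrC.
  by rewrite ltr_pdivrMr // ler_pdivrMr // !mul1r ltrDl; apply.
have := self_adj (cstar a ** a); rewrite cstarM cstarK => /(_ erefl).
by rewrite fM fs !nm_cstar_mul ler_pXn2r ?nnegrE ?nm_ge0.
Qed.

(** * Approximate units in Hilbert modules *)

Section ApproximateUnit.
Variables (R : realType) (A : cstarAlgType R) (X : hilbertModType A).
Implicit Types (x y z : X) (a b c h : A).

Lemma innerBr x y z : inner x (y - z) = inner x y - inner x z :> A.
Proof.
by rewrite addrC -scaleN1r innerPr scaleN1r addrC.
Qed.
Lemma innerBl x y z : inner (x - y) z = inner x z - inner y z :> A.
Proof. by rewrite -inner_star innerBr cstarB !inner_star. Qed.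
Lemma inner_ractl x a y : inner (ract x a) y = cstar a ** inner x y.
Proof. by rewrite -inner_star inner_ract cstarM inner_star. Qed.
Lemma nm_inner x : nm (inner x x : A) = nm x ^+ 2.
Proof. by apply: (@complexI R); rewrite rmorphXn /= -!nmE inner_norm. Qed.

(* With y = 1 - h^2, the Cesaro means of the contractions y^j are of the form
   1 - c, and (1 - c) h^2 = (1 - y^n) / n. *)
Lemma cesaro_unit h (e : R) : cstar h = h -> nm h < 1 -> 0 < e ->
  exists c, [/\ cstar c = c, c ** h = h ** c,
    forall w, nm (w - c ** w) <= nm w & nm (h - c ** h) < e].
Proof.
move=> hs h1 e0; pose H := h ** h.
have Hs : cstar H = H by rewrite cstarM hs.
have H1 : nm H < 1 by rewrite /H -{1}hs nm_cstar_mul expr_lt1 // nm_ge0.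
have [k [ks kk kz]] := sqrt_complement Hs H1.
have kh : k ** h = h ** k by rewrite kz // cmulA.
(* $1-H=(1-k)^2$ is the square of a contraction. *)
have Y1 w : nm (w - H ** w) <= nm w.
  have c1 w' := (circle_elements ks hs kh kk w').1.
  apply: le_trans (c1 w); apply: le_trans (c1 _); rewrite -kk.
  rewrite le_eqVlt; apply/orP; left; apply/eqP; congr nm.
  by rewrite cmulBr !cmulBl cmulDl !cmulA; zmod.
(* Unit-free notation: [z n] is $1-y^n$ and [S n] is $\sum_{j<n}(1-y^j)$, so $1-S_n/n$ is the mean
   of the $y^j$. *)
pose fix z n := if n is m.+1 then z m + H - H ** z m else 0.
pose fix S n := if n is m.+1 then S m + z m else 0.
have zh n : z n ** h = h ** z n.
  elim: n => [|n IHn] /=; first by rewrite cmul0l cmul0r.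
  by rewrite cmulBl cmulDl cmulBr cmulDr IHn -cmulA IHn /H -!cmulA.
have zH n : z n ** H = H ** z n by rewrite /H cmulA zh -cmulA zh cmulA.
have zs n : cstar (z n) = z n.
  elim: n => [|n IHn] /=; first exact: cstar0.
  by rewrite cstarB cstarD cstarM IHn Hs zH.
have z1 n w : nm (w - z n ** w) <= nm w.
  elim: n => [|n IHn] /=; first by rewrite cmul0l subr0.
  apply: le_trans IHn; apply: le_trans (Y1 _).
  rewrite le_eqVlt; apply/orP; left; apply/eqP; congr nm.
  by rewrite cmulBr cmulBl cmulDl !cmulA; zmod.
(* $|z|^2=|z^2|\le|z|+|z-z^2|\le 2|z|$ for self-adjoint $z=z_n$. *)
have z2 n : nm (z n) <= 2.
  have [->|n0] := eqVneq (nm (z n)) 0; first exact: ler0n.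
  have n1 : 0 < nm (z n) by rewrite lt_neqAle eq_sym n0 nm_ge0.
  rewrite -(ler_pM2r n1) -expr2 -nm_cstar_mul zs.
  have := nmB (z n) (z n - z n ** z n); have := z1 n (z n).
  by rewrite subKr; lra.
have Sh n : S n ** h = h ** S n.
  elim: n => [|n IHn] /=; first by rewrite cmul0l cmul0r.
  by rewrite cmulDl cmulDr IHn zh.
have Ss n : cstar (S n) = S n.
  by elim: n => [|n IHn] /=; [exact: cstar0 | rewrite cstarD IHn zs].
have S1 n w : nm (w *+ n - S n ** w) <= n%:R * nm w.
  elim: n => [|n IHn] /=; first by rewrite mulr0n cmul0l subrr nm0 mul0r.
  rewrite mulrSr cmulDl opprD addrACA (le_trans (nmD _ _)) //.
  by rewrite -natr1 mulrDl mul1r lerD.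
have SH n : H *+ n - S n ** H = z n.
  elim: n => [|n IHn] /=; first by rewrite mulr0n cmul0l subrr.
  by rewrite mulrSr cmulDl opprD addrACA IHn zH addrA.
(* Below, $|h-ch|^2=|(1-c)^2H|\le|(1-c)H|=|z_{n+1}|/(n+1)\le 2/(n+1)$, which must be less than
   $e^2$. *)
have [n hn] : exists n : nat, 2 / e ^+ 2 < n.+1%:R.
  exists (Num.bound (2 / e ^+ 2)); apply: (lt_le_trans (archi_boundP _)).
    by rewrite divr_ge0 // exprn_ge0 // ltW.
  by rewrite ler_nat.
pose t : R[i] := ((n.+1%:R^-1 : R)%:C)%C.
have n0 : 0 < n.+1%:R^-1 :> R by rewrite invr_gt0 ltr0n.
have nt (w : A) : nm (t *: w) = n.+1%:R^-1 * nm w by rewrite nmZR gtr0_norm.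
have tn1 : t * n.+1%:R = 1.
  by rewrite /t fmorphV /= rmorph_nat mulVf // pnatr_eq0.
have tn (w : A) : t *: (w *+ n.+1) = w.
  by rewrite -scaler_nat scalerA tn1 scale1r.
pose c := t *: S n.+1.
have cw w : w - c ** w = t *: (w *+ n.+1 - S n.+1 ** w).
  by rewrite scalerBr tn -cmulZl.
have ch : c ** h = h ** c by rewrite cmulZl cmulZr Sh.
have cs : cstar c = c by rewrite /c cstarZ Ss conjc_real.
have c1 w : nm (w - c ** w) <= nm w.
  by rewrite cw nt mulrC ler_pdivrMr ?ltr0n // mulrC S1.
exists c; split=> //.
have v2 : nm (h - c ** h) ^+ 2 < e ^+ 2.
  have -> : nm (h - c ** h) ^+ 2 = nm ((H - c ** H) - c ** (H - c ** H)).
    rewrite -nm_cstar_mul cstarB cstarM cs hs cmulBl !cmulBr !cmulA.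
    have hcc : h ** c ** c = c ** c ** h by rewrite -ch -cmulA -ch cmulA.
    by rewrite hcc -ch.
  rewrite (le_lt_trans (c1 _)) // cw SH nt mulrC ltr_pdivrMr ?ltr0n //.
  by rewrite (le_lt_trans (z2 _)) // mulrC -ltr_pdivrMr // exprn_gt0.
by rewrite -(@ltr_pXn2r _ 2) // ?nnegrE ?nm_ge0 // ltW.
Qed.

(** If $c$ commutes with $h_0=\langle x,x\rangle$, then $|x-xc|^2=|(1-c)(1-c)h_0|\le|(1-c)h_0|$. The
    factor $s$ brings $h_0$ into the open unit ball required by [cesaro_unit]. *)
Lemma approximate_unit x (e : R) : 0 < e -> exists c, nm (x - ract x c) < e.
Proof.
move=> e0; pose h0 : A := inner x x; pose s := (nm h0 + 1)^-1.
have n0 : 0 < nm h0 + 1 by rewrite ltr_wpDl // nm_ge0.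
have s0 : 0 < s by rewrite invr_gt0.
pose h := ((s%:C)%C : R[i]) *: h0.
have hs : cstar h = h by rewrite cstarZ conjc_real inner_star.
have h1 : nm h < 1.
  by rewrite nmZR gtr0_norm // mulrC ltr_pdivrMr // mul1r ltrDl.
have [|c [cs ch c1 he]] := @cesaro_unit h (s * e ^+ 2) hs h1.
  by rewrite mulr_gt0 // exprn_gt0.
exists c; rewrite -(@ltr_pXn2r _ 2) // ?nnegrE ?nm_ge0 ?ltW // -nm_inner.
rewrite innerBl !innerBr inner_ract !inner_ractl cs inner_ract -/h0.
have ch0 : c ** h0 = h0 ** c.
  move: ch; rewrite cmulZl cmulZr => /(congr1 (fun w => ((s^-1)%:C)%C *: w)).
  by rewrite !scalerA -rmorphM mulVf ?scale1r // gt_eqF.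
rewrite -ch0 -cmulBr; apply: le_lt_trans (c1 _) _.
move: he; rewrite cmulZr -scalerBr nmZR gtr0_norm // ltr_pM2l //.
Qed.
End ApproximateUnit.

(** * Cauchy's theorem, Fourier uniqueness and entire functions *)

Section RealIntegral.
Variable R : realType.
Implicit Types (u v : R -> R) (a b c : R).

(** An integral over a set, hence 0 when $b<a$ and not the oriented integral; the length formulas
    below ask for $a\le b$. *)
Definition rint u a b : R := (\int[@lebesgue_measure R]_(x in `[a, b]) u x)%R.

Lemma cont_integrable u a b : continuous u ->
  (@lebesgue_measure R).-integrable `[a, b] (EFin \o u).
Proof.
move=> cu; apply: continuous_compact_integrable; first exact: segment_compact.
exact: continuous_subspaceT.
Qed.

Lemma rintD u v a b : continuous u -> continuous v ->
  rint (fun x => u x + v x) a b = rint u a b + rint v a b.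
Proof. by move=> cu cv; rewrite /rint RintegralD //; exact: cont_integrable. Qed.

Lemma rintZ k u a b : continuous u -> rint (fun x => k * u x) a b = k * rint u a b.
Proof. by move=> cu; rewrite /rint RintegralZl //; exact: cont_integrable. Qed.

Lemma rint_cst k a b : a <= b -> rint (fun=> k) a b = k * (b - a).
Proof.
move=> ab; rewrite /rint Rintegral_cst //= lebesgue_measure_itv /= lte_fin.
by move: ab; rewrite le_eqVlt => /predU1P[->|->]; rewrite ?ltxx ?subrr.
Qed.

Lemma rint_le u v a b : continuous u -> continuous v ->
  (forall x, a <= x <= b -> u x <= v x) -> rint u a b <= rint v a b.
Proof.
move=> cu cv h; apply: le_Rintegral => //; try exact: cont_integrable.
Qed.

Lemma rint_split u a b c : continuous u -> a <= b -> b <= c ->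
  rint u a c = rint u a b + rint u b c.
Proof.
move=> cu ab bc; have := @Rintegral_itvB R u (BLeft a) (BRight c) b.
rewrite !bnd_simp => /(_ (cont_integrable _ _ cu) ab bc).
rewrite Rintegral_itv_obnd_cbnd; last first.
  by apply: integrableS (cont_integrable b c cu) => //; exact: subset_itv_oc_cc.
by rewrite /rint => <-; rewrite addrC subrK.
Qed.

Lemma rint_id a b : a <= b -> rint (fun x => x) a b = (b ^+ 2 - a ^+ 2) / 2.
Proof.
rewrite le_eqVlt => /predU1P[->|ab].
  by rewrite subrr mul0r /rint set_itv1 Rintegral_set1.
rewrite /rint /Rintegral.
rewrite (@continuous_FTC2 R (fun x => x) (fun x => 2^-1 * x ^+ 2) a b) //=.
- by field.
- by apply: continuous_subspaceT => x; exact: cvg_id.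
- split=> [x _||].
  + exact: ex_derive.
  + apply: cvg_at_right_filter.
    by apply: (@cvgM _ _ _ _ (fun=> _) (fun x => x ^+ 2));
      [exact: cvg_cst | exact: exprn_continuous].
  + apply: cvg_at_left_filter.
    by apply: (@cvgM _ _ _ _ (fun=> _) (fun x => x ^+ 2));
      [exact: cvg_cst | exact: exprn_continuous].
- by move=> x _; rewrite derive1E derive_val /= /GRing.scale /=; field.
Qed.

End RealIntegral.

(** * Continuity and integration of complex functions of a real variable *)

Section ComplexIntegral.
Variable R : realType.
Implicit Types (z w : R[i]) (f g : R -> R[i]) (a b c : R).
Local Open Scope complex_scope.

Lemma nm_Re z : `|complex.Re z| <= nm z.
Proof.
case: z => x y; rewrite -(sqrtr_sqr x) /nm normc_def /=.
by rewrite ler_sqrt ?lerDl ?addr_ge0 ?sqr_ge0.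
Qed.

Lemma nm_Im z : `|complex.Im z| <= nm z.
Proof.
case: z => x y; rewrite -(sqrtr_sqr y) /nm normc_def /=.
by rewrite ler_sqrt ?lerDr ?addr_ge0 ?sqr_ge0.
Qed.

Lemma nm_ReIm (x y : R) : nm (x +i* y) <= `|x| + `|y|.
Proof.
by rewrite [x +i* y]complexE /= (le_trans (nmD _ _)) // nmM nmi mul1r !nmR.
Qed.

Definition ccont g := forall x (e : R), 0 < e ->
  exists2 d, 0 < d & forall y, `|y - x| < d -> nm (g y - g x) < e.

Lemma ccont_part (P : R[i] -> R) g : (forall z w, P (z - w) = P z - P w) ->
  (forall z, `|P z| <= nm z) -> ccont g -> continuous (fun x => P (g x)).
Proof.
move=> PB Ple cg x; apply/cvgrPdist_lt => e e0.
have [d d0 hd] := cg x e e0; near=> y.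
rewrite -PB (le_lt_trans (Ple _)) // nm_distC; apply: hd; near: y.
by exists d => //= y; rewrite distrC.
Unshelve. all: by end_near. Qed.

Lemma ccont_Re g : ccont g -> continuous (fun x => complex.Re (g x)).
Proof. by apply: ccont_part; [case=> ? ? [] | exact: nm_Re]. Qed.

Lemma ccont_Im g : ccont g -> continuous (fun x => complex.Im (g x)).
Proof. by apply: ccont_part; [case=> ? ? [] | exact: nm_Im]. Qed.

Lemma ccont_cst z : ccont (fun=> z).
Proof. by move=> x e e0; exists 1 => // y _; rewrite subrr nm0. Qed.

Lemma ccontD f g : ccont f -> ccont g -> ccont (fun x => f x + g x).
Proof.
move=> cf cg x e e0; have e2 : 0 < e / 2 by lra.
have [d d0 hd] := cf x _ e2; have [d' d0' hd'] := cg x _ e2.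
exists (Num.min d d'); first by rewrite lt_min d0.
move=> y; rewrite lt_min => /andP[/hd h /hd' h'].
rewrite opprD addrACA (le_lt_trans (nmD _ _)) //.
by rewrite [e](splitr e) ltrD.
Qed.

Lemma ccontM f g : ccont f -> ccont g -> ccont (fun x => f x * g x).
Proof.
move=> cf cg x e e0.
pose M := nm (f x) + nm (g x) + 1.
have M0 : 0 < M by rewrite ltr_wpDl // addr_ge0 ?nm_ge0.
(* The three error terms add up to at most $M\cdot e/(2M)=e/2$; the bound 1 handles the product of
   the two increments. *)
pose e' := Num.min 1 (e / (2 * M)).
have e0' : 0 < e' by rewrite lt_min ltr01 divr_gt0 // mulr_gt0.
have [d d0 hd] := cf x _ e0'; have [d' d0' hd'] := cg x _ e0'.
exists (Num.min d d'); first by rewrite lt_min d0.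
move=> y; rewrite lt_min => /andP[/hd h /hd' h'].
have -> : f y * g y - f x * g x = (f y - f x) * (g y - g x) + (f y - f x) * g x
  + f x * (g y - g x) by ring.
have h1 : nm (f y - f x) < 1 by move: h; rewrite lt_min => /andP[].
have h3 : nm (g y - g x) < e / (2 * M) by move: h'; rewrite lt_min => /andP[].
have h4 : nm (f y - f x) < e / (2 * M) by move: h; rewrite lt_min => /andP[].
have := nmD ((f y - f x) * (g y - g x) + (f y - f x) * g x) (f x * (g y - g x)).
have := nmD ((f y - f x) * (g y - g x)) ((f y - f x) * g x); rewrite !nmM.
set p := nm (f y - f x) in h h1 h4 *; set q := nm (g y - g x) in h' h3 *.
have p0 : 0 <= p by exact: nm_ge0. have q0 : 0 <= q by exact: nm_ge0.
have E : e = 2 * (M * (e / (2 * M))) by field; rewrite gt_eqF.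
move: E; rewrite /M; set t := e / _ in h3 h4 * => E.
have gx : 0 <= nm (g x) by exact: nm_ge0. have fx : 0 <= nm (f x) by exact: nm_ge0.
have : p * q <= 1 * t by apply: ler_pM => //; exact: ltW.
have : p * nm (g x) <= t * nm (g x) by apply: ler_wpM2r => //; exact: ltW.
have : nm (f x) * q <= nm (f x) * t by apply: ler_wpM2l => //; exact: ltW.
have t0 : 0 < t by rewrite /t divr_gt0 // mulr_gt0.
have : 0 <= nm (f x) * t by rewrite mulr_ge0 // ltW.
have : 0 <= t * nm (g x) by rewrite mulr_ge0 // ltW.
rewrite [in X in _ -> _ -> _ -> _ -> _ -> _ -> _ -> _ < X]E; nra.
Qed.

Lemma ccontB f g : ccont f -> ccont g -> ccont (fun x => f x - g x).
Proof.
move=> cf cg; have := ccontD cf (ccontM (ccont_cst (- 1)) cg).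
by move=> h x e /(h x)[d d0 hd]; exists d => // y /hd; rewrite !mulN1r.
Qed.

Definition cint f a b : R[i] :=
  rint (fun x => complex.Re (f x)) a b +i* rint (fun x => complex.Im (f x)) a b.

Lemma eq_cint f g a b : f =1 g -> cint f a b = cint g a b.
Proof. by move/funext ->. Qed.

Lemma cintD f g a b : ccont f -> ccont g ->
  cint (fun x => f x + g x) a b = cint f a b + cint g a b.
Proof.
move=> cf cg; apply/eqP; rewrite eq_complex /cint /=.
rewrite -!rintD; try exact: ccont_Re; try exact: ccont_Im.
by apply/andP; split; apply/eqP; congr rint; apply/funext => x; case: (f x) (g x) => ? ? [].
Qed.

Lemma cintZ k f a b : ccont f -> cint (fun x => k * f x) a b = k * cint f a b.
Proof.
move=> cf; case: k => k l; apply/eqP; rewrite eq_complex /cint /=.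
have cR := ccont_Re cf; have cI := ccont_Im cf.
rewrite -mulNr -!rintZ // -!rintD //.
- apply/andP; split; apply/eqP; congr rint; apply/funext => x;
    by case: (f x) => ? ? /=; rewrite ?mulNr.
- by move=> x; apply: cvgM; [exact: cvg_cst | exact: cI].
- by move=> x; apply: cvgM; [exact: cvg_cst | exact: cR].
- by move=> x; apply: cvgM; [exact: cvg_cst | exact: cR].
- by move=> x; apply: cvgM; [exact: cvg_cst | exact: cI].
Qed.

Lemma cintB f g a b : ccont f -> ccont g ->
  cint (fun x => f x - g x) a b = cint f a b - cint g a b.
Proof.
move=> cf cg; rewrite -mulN1r -cintZ // -cintD //; last first.
  exact: ccontM (ccont_cst _) cg.
by apply: eq_cint => x; rewrite mulN1r.
Qed.

Lemma cint_split f a b c : ccont f -> a <= b -> b <= c ->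
  cint f a c = cint f a b + cint f b c.
Proof.
move=> cf ab bc; rewrite /cint.
rewrite (rint_split (ccont_Re cf) ab bc) (rint_split (ccont_Im cf) ab bc).
by [].
Qed.

(** The factor 2 comes from estimating real and imaginary parts separately; constants are harmless
    in the limit arguments that follow. *)
Lemma cint_bound f a b (M : R) : a <= b -> ccont f ->
  (forall x, a <= x <= b -> nm (f x) <= M) -> nm (cint f a b) <= 2 * M * (b - a).
Proof.
move=> ab cf h; rewrite (le_trans (nm_ReIm _ _)) // -mulrA mulrDl !mul1r.
have bnd u : continuous u -> (forall x, a <= x <= b -> `|u x| <= M) ->
    `|rint u a b| <= M * (b - a).
  move=> cu hu; rewrite ler_norml -mulNr -!rint_cst //; apply/andP; split.
    by apply: rint_le => // [x|x /hu]; [exact: cvg_cst | rewrite ler_norml => /andP[]].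
  by apply: rint_le => // [x|x /hu]; [exact: cvg_cst | rewrite ler_norml => /andP[]].
apply: lerD; apply: bnd; try exact: ccont_Re; try exact: ccont_Im.
  by move=> x /h; apply: le_trans (nm_Re _).
by move=> x /h; apply: le_trans (nm_Im _).
Qed.

Lemma cint_cst k a b : a <= b -> cint (fun=> k) a b = k * (b - a)%:C.
Proof.
move=> ab; rewrite /cint !rint_cst //; case: k => x y /=.
by apply/eqP; rewrite eq_complex /= !mulr0 subr0 add0r !eqxx.
Qed.

Lemma ccont_real : ccont (fun x => x%:C).
Proof. by move=> x e e0; exists e => // y h; rewrite -rmorphB nmR. Qed.

Lemma cint_id a b : a <= b -> cint (fun x => x%:C) a b = ((b ^+ 2 - a ^+ 2) / 2)%:C.
Proof. by move=> ab; rewrite /cint /= rint_cst // rint_id // mul0r. Qed.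

Lemma cint_affine k l a b : a <= b ->
  cint (fun x => k + l * x%:C) a b = k * (b - a)%:C + l * ((b ^+ 2 - a ^+ 2) / 2)%:C.
Proof.
move=> ab; have cr := ccont_real; have ck := ccont_cst.
by rewrite cintD ?cintZ ?cint_cst ?cint_id //; exact: ccontM.
Qed.

End ComplexIntegral.

(** * Complex differentiability and Goursat's theorem for rectangles *)

Section Goursat.
Variable R : realType.
Implicit Types (z w : R[i]) (f g : R[i] -> R[i]).
Local Open Scope complex_scope.

(** The quotient-free form of the derivative with real error bounds, so that $h=0$ is no
    exception. *)
Definition cdiff_at f z := exists d : R[i], forall e : R, 0 < e ->
  exists2 r : R, 0 < r & forall h, nm h < r ->
    nm (f (z + h) - f z - h * d) <= e * nm h.

Definition cdiff f := forall z, cdiff_at f z.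

Lemma complexRI (x y : R) : x +i* y = x%:C + 'i * y%:C.
Proof. by rewrite [LHS]complexE. Qed.

Lemma cdiff_cont f z : cdiff_at f z -> forall e : R, 0 < e ->
  exists2 r : R, 0 < r & forall h, nm h < r -> nm (f (z + h) - f z) < e.
Proof.
move=> [d hd] e e0; have [r r0 hr] := hd 1 ltr01.
have M0 : 0 < nm d + 1 by rewrite ltr_wpDl // nm_ge0.
exists (Num.min r (e / (nm d + 1))); first by rewrite lt_min r0 divr_gt0.
move=> h; rewrite lt_min => /andP[/hr h1]; rewrite ltr_pdivlMr // => h2.
have := nmD (f (z + h) - f z - h * d) (h * d).
by rewrite subrK nmM; lra.
Qed.

Lemma cdiff_ccont_re f (y : R) : cdiff f -> ccont (fun x : R => f (x +i* y)).
Proof.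
move=> df x e e0; have [r r0 hr] := cdiff_cont (df (x +i* y)) e0.
exists r => // x' hx; have := hr (x' - x)%:C; rewrite nmR => /(_ hx).
by have -> : x +i* y + (x' - x)%:C = x' +i* y
  by apply/eqP; rewrite eq_complex /= addr0 addrC subrK !eqxx.
Qed.

Lemma cdiff_ccont_im f (x : R) : cdiff f -> ccont (fun y : R => f (x +i* y)).
Proof.
move=> df y e e0; have [r r0 hr] := cdiff_cont (df (x +i* y)) e0.
exists r => // y' hy; have := hr ('i * (y' - y)%:C); rewrite nmM nmi mul1r nmR => /(_ hy).
by have -> : x +i* y + 'i * (y' - y)%:C = x +i* y'
  by rewrite (complexRI x y) (complexRI x y') rmorphB; ring.
Qed.

(** The counterclockwise contour integral: bottom minus top, plus $i$ times right minus left. *)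
Definition rectint f (x1 x2 y1 y2 : R) : R[i] :=
  cint (fun x => f (x +i* y1)) x1 x2 - cint (fun x => f (x +i* y2)) x1 x2
  + 'i * (cint (fun y => f (x2 +i* y)) y1 y2 - cint (fun y => f (x1 +i* y)) y1 y2).

Lemma rectint_split_re f x1 x2 x3 y1 y2 : cdiff f -> x1 <= x2 -> x2 <= x3 ->
  rectint f x1 x3 y1 y2 = rectint f x1 x2 y1 y2 + rectint f x2 x3 y1 y2.
Proof.
move=> df h12 h23; rewrite /rectint.
rewrite (cint_split (cdiff_ccont_re y1 df) h12 h23).
rewrite (cint_split (cdiff_ccont_re y2 df) h12 h23).
by ring.
Qed.

Lemma rectint_split_im f x1 x2 y1 y2 y3 : cdiff f -> y1 <= y2 -> y2 <= y3 ->
  rectint f x1 x2 y1 y3 = rectint f x1 x2 y1 y2 + rectint f x1 x2 y2 y3.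
Proof.
move=> df h12 h23; rewrite /rectint.
rewrite (cint_split (cdiff_ccont_im x1 df) h12 h23).
rewrite (cint_split (cdiff_ccont_im x2 df) h12 h23).
by ring.
Qed.

Lemma rectint_quarter f x y (s t : R) : cdiff f -> 0 <= s -> 0 <= t ->
  rectint f x (x + (s + s)) y (y + (t + t)) =
  rectint f x (x + s) y (y + t) + rectint f x (x + s) (y + t) (y + t + t) +
  (rectint f (x + s) (x + s + s) y (y + t)
   + rectint f (x + s) (x + s + s) (y + t) (y + t + t)).
Proof.
move=> df s0 t0; rewrite !addrA.
rewrite (@rectint_split_re f x (x + s)) ?lerDl //.
rewrite (@rectint_split_im f x (x + s) y (y + t)) ?lerDl //.
rewrite (@rectint_split_im f (x + s) (x + s + s) y (y + t)) ?lerDl //.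
by rewrite !addrA.
Qed.

Lemma cdiff_affine_poly k l : cdiff (fun w => k + l * w).
Proof.
move=> z; exists l => e e0; exists 1 => // h _.
have -> : k + l * (z + h) - (k + l * z) - h * l = 0 by ring.
by rewrite nm0 mulr_ge0 ?nm_ge0 // ltW.
Qed.

Lemma rectint_affine k l x1 x2 y1 y2 : x1 <= x2 -> y1 <= y2 ->
  rectint (fun w => k + l * w) x1 x2 y1 y2 = 0.
Proof.
move=> hx hy; rewrite /rectint.
have xE y : (fun x : R => k + l * (x +i* y)) =1 (fun x => (k + l * ('i * y%:C)) + l * x%:C).
  by move=> x; rewrite complexRI; ring.
have yE x : (fun y : R => k + l * (x +i* y)) =1 (fun y => (k + l * x%:C) + (l * 'i) * y%:C).
  by move=> y; rewrite complexRI; ring.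
(* The cancellation does not use $i^2=-1$, so ['i] is generalised to [j] and [ring] applies. *)
have key (j X1 X2 Y1 Y2 p q : R[i]) :
  (k + l * (j * Y1)) * (X2 - X1) + l * p - ((k + l * (j * Y2)) * (X2 - X1) + l * p)
  + j * ((k + l * X2) * (Y2 - Y1) + l * j * q - ((k + l * X1) * (Y2 - Y1) + l * j * q)) = 0.
  by ring.
by rewrite !(eq_cint _ _ (xE _)) !(eq_cint _ _ (yE _)) !cint_affine // !rmorphB; exact: key.
Qed.

Lemma rectintB f g x1 x2 y1 y2 : cdiff f -> cdiff g ->
  rectint (fun w => f w - g w) x1 x2 y1 y2 = rectint f x1 x2 y1 y2 - rectint g x1 x2 y1 y2.
Proof.
move=> df dg; rewrite /rectint !cintB; try exact: cdiff_ccont_re; try exact: cdiff_ccont_im.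
by ring.
Qed.

Lemma cdiffB f g : cdiff f -> cdiff g -> cdiff (fun w => f w - g w).
Proof.
move=> df dg z; have [d hd] := df z; have [d' hd'] := dg z.
exists (d - d') => e e0; have e2 : 0 < e / 2 by lra.
have [r r0 hr] := hd _ e2; have [r' r0' hr'] := hd' _ e2.
exists (Num.min r r'); first by rewrite lt_min r0.
move=> h; rewrite lt_min => /andP[/hr h1 /hr' h2].
have -> : f (z + h) - g (z + h) - (f z - g z) - h * (d - d') =
  (f (z + h) - f z - h * d) - (g (z + h) - g z - h * d') by ring.
by have := nmB (f (z + h) - f z - h * d) (g (z + h) - g z - h * d'); lra.
Qed.

Lemma rectint_bound f x1 x2 y1 y2 (M : R) : cdiff f -> x1 <= x2 -> y1 <= y2 ->
  (forall x y, x1 <= x <= x2 -> y1 <= y <= y2 -> nm (f (x +i* y)) <= M) ->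
  nm (rectint f x1 x2 y1 y2) <= 4 * M * ((x2 - x1) + (y2 - y1)).
Proof.
move=> df hx hy hM.
have b1 : nm (cint (fun x => f (x +i* y1)) x1 x2) <= 2 * M * (x2 - x1).
  apply: cint_bound => // [|x xx]; first exact: cdiff_ccont_re.
  by apply: hM => //; rewrite lexx.
have b2 : nm (cint (fun x => f (x +i* y2)) x1 x2) <= 2 * M * (x2 - x1).
  apply: cint_bound => // [|x xx]; first exact: cdiff_ccont_re.
  by apply: hM => //; rewrite lexx andbT.
have b3 : nm (cint (fun y => f (x2 +i* y)) y1 y2) <= 2 * M * (y2 - y1).
  apply: cint_bound => // [|x xx]; first exact: cdiff_ccont_im.
  by apply: hM => //; rewrite lexx andbT.
have b4 : nm (cint (fun y => f (x1 +i* y)) y1 y2) <= 2 * M * (y2 - y1).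
  apply: cint_bound => // [|x xx]; first exact: cdiff_ccont_im.
  by apply: hM => //; rewrite lexx.
rewrite /rectint.
set A := cint _ _ _ in b1 *; set B := cint _ _ _ in b2 *.
set C := cint _ _ _ in b3 *; set D := cint _ _ _ in b4 *.
have := nmD (A - B) ('i * (C - D)); rewrite nmM nmi mul1r.
by have := nmB A B; have := nmB C D; lra.
Qed.

(** Subtracting the affine approximation at the point leaves the contour integral unchanged and a
    remainder of size $(e/4)s$, where $s$ is half the perimeter; the 4 cancels the constant of
    [rectint_bound]. *)
Lemma rectint_local f (px py e : R) : cdiff f -> 0 < e ->
  exists2 r : R, 0 < r & forall x1 x2 y1 y2, x1 <= px <= x2 -> y1 <= py <= y2 ->
    (x2 - x1) + (y2 - y1) < r ->
    nm (rectint f x1 x2 y1 y2) <= e * ((x2 - x1) + (y2 - y1)) ^+ 2.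
Proof.
move=> df e0; pose p := px +i* py; have [d hd] := df p.
have e4 : 0 < e / 4 by lra.
have [r r0 hr] := hd _ e4; exists r => // x1 x2 y1 y2 /andP[hx1 hx2] /andP[hy1 hy2] hs.
have hx := le_trans hx1 hx2; have hy := le_trans hy1 hy2.
pose s := (x2 - x1) + (y2 - y1).
pose A w := (f p - p * d) + d * w.
have dA : cdiff A by exact: cdiff_affine_poly.
have := @rectint_bound (fun w => f w - A w) x1 x2 y1 y2 (e / 4 * s) (cdiffB df dA) hx hy.
rewrite rectintB // rectint_affine // subr0 -/s.
have -> : 4 * (e / 4 * s) * s = e * s ^+ 2 by field.
apply=> x y /andP[ax bx] /andP[ay by_].
have hb : nm (x +i* y - p) <= s.
  have -> : x +i* y - p = (x - px) +i* (y - py) by [].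
  apply: (le_trans (nm_ReIm _ _)); rewrite /s; apply: lerD; rewrite ler_norml; lra.
have := hr (x +i* y - p); rewrite (addrC p) subrK => /(_ (le_lt_trans hb hs)).
have -> : f (x +i* y) - f p - (x +i* y - p) * d = f (x +i* y) - A (x +i* y).
  by rewrite /A; ring.
by move=> /le_trans; apply; rewrite ler_pM2l.
Qed.

(** The supremum of the left ends lies in all the nested intervals. It is used for each coordinate
    of the bisected rectangles. *)
Lemma nested_point (u : nat -> R) (l : R) : 0 <= l ->
  (forall n, u n <= u n.+1) -> (forall n, u n.+1 <= u n + l / 2 ^+ n.+1) ->
  exists p, forall n, u n <= p <= u n + l / 2 ^+ n.
Proof.
move=> l0 up dn.
have lE n : l / 2 ^+ n = l / 2 ^+ n.+1 + l / 2 ^+ n.+1.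
  by rewrite exprS; field; rewrite expf_neq0.
have upm n m : (n <= m)%N -> u n <= u m.
  move=> /subnKC <-; elim: (m - n)%N => [|k IHk]; first by rewrite addn0.
  by rewrite addnS (le_trans IHk).
have dnm n m : (n <= m)%N -> u m + l / 2 ^+ m <= u n + l / 2 ^+ n.
  move=> /subnKC <-; elim: (m - n)%N => [|k IHk]; first by rewrite addn0.
  rewrite addnS; apply: le_trans IHk; rewrite [X in _ <= _ + X]lE.
  by rewrite addrA lerD2r.
have ln n : 0 <= l / 2 ^+ n by rewrite divr_ge0 // exprn_ge0.
have umn n m : u n <= u m + l / 2 ^+ m.
  have [nm|/ltnW mn] := leqP n m.
    by rewrite (le_trans (upm _ _ nm)) // lerDl.
  by apply: le_trans (dnm _ _ mn); rewrite lerDl.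
exists (sup (range u)) => n; apply/andP; split.
  apply: ub_le_sup; last by exists n.
  by exists (u 0%N + l / 2 ^+ 0) => _ [m _ <-].
apply: ge_sup; first by exists (u 0%N), 0%N.
by move=> _ [m _ <-].
Qed.

Lemma quarter_max (a b c d : R[i]) (q : R) : q <= nm (a + b + (c + d)) ->
  q <= 4 * nm a \/ q <= 4 * nm b \/ q <= 4 * nm c \/ q <= 4 * nm d.
Proof.
move=> h; have := nmD (a + b) (c + d); have := nmD a b; have := nmD c d => h1 h2 h3.
have [?|ha] := leP q (4 * nm a); first by left.
have [?|hb] := leP q (4 * nm b); first by right; left.
have [?|hc] := leP q (4 * nm c); first by right; right; left.
by right; right; right; lra.
Qed.

Lemma goursat f x1 x2 y1 y2 : cdiff f -> x1 <= x2 -> y1 <= y2 ->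
  rectint f x1 x2 y1 y2 = 0.
Proof.
move=> df hx hy; apply: nm_small0 => e0 e0_gt0; rewrite leNgt; apply/negP => J0.
pose s := x2 - x1; pose t := y2 - y1.
have s0 : 0 <= s by rewrite subr_ge0. have t0 : 0 <= t by rewrite subr_ge0.
pose Q n (p : R * R) :=
  rectint f p.1 (p.1 + s / 2 ^+ n) p.2 (p.2 + t / 2 ^+ n).
have hlf l n : l / 2 ^+ n = l / 2 ^+ n.+1 + l / 2 ^+ n.+1 :> R.
  by rewrite exprS; field; rewrite expf_neq0.
have pos l n : 0 <= l -> 0 <= l / 2 ^+ n :> R.
  by move=> l0; rewrite divr_ge0 // exprn_ge0.
have step n p : {p' : R * R | [/\ p.1 <= p'.1 <= p.1 + s / 2 ^+ n.+1,
   p.2 <= p'.2 <= p.2 + t / 2 ^+ n.+1 & nm (Q n p) <= 4 * nm (Q n.+1 p')]}.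
  apply: cid; case: p => x y /=.
  have ps := pos s n.+1 s0; have pt := pos t n.+1 t0.
  have := @quarter_max (Q n.+1 (x, y)) (Q n.+1 (x, y + t / 2 ^+ n.+1))
   (Q n.+1 (x + s / 2 ^+ n.+1, y)) (Q n.+1 (x + s / 2 ^+ n.+1, y + t / 2 ^+ n.+1))
   (nm (Q n (x, y))).
  have -> : Q n (x, y) = Q n.+1 (x, y) + Q n.+1 (x, y + t / 2 ^+ n.+1) +
   (Q n.+1 (x + s / 2 ^+ n.+1, y) + Q n.+1 (x + s / 2 ^+ n.+1, y + t / 2 ^+ n.+1)).
    by rewrite /Q /= (hlf s n) (hlf t n) rectint_quarter.
  move=> /(_ (lexx _)) [|[|[|]]] h.
  - by exists (x, y); rewrite /= !lexx !lerDl ps pt.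
  - by exists (x, y + t / 2 ^+ n.+1); rewrite /= !lexx !lerDl ps pt.
  - by exists (x + s / 2 ^+ n.+1, y); rewrite /= !lexx !lerDl ps pt.
  - by exists (x + s / 2 ^+ n.+1, y + t / 2 ^+ n.+1); rewrite /= !lexx !lerDl ps pt.
pose fix P n : R * R := if n is m.+1 then sval (step m (P m)) else (x1, y1).
have PS n : [/\ (P n).1 <= (P n.+1).1 <= (P n).1 + s / 2 ^+ n.+1,
   (P n).2 <= (P n.+1).2 <= (P n).2 + t / 2 ^+ n.+1
   & nm (Q n (P n)) <= 4 * nm (Q n.+1 (P n.+1))].
  exact: svalP (step n (P n)).
have [px hpx] : exists p, forall n, (P n).1 <= p <= (P n).1 + s / 2 ^+ n.
  by apply: nested_point => // n; have [/andP[]] := PS n.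
have [py hpy] : exists p, forall n, (P n).2 <= p <= (P n).2 + t / 2 ^+ n.
  by apply: nested_point => // n; have [_ /andP[]] := PS n.
(* One quarter always keeps at least a fourth of the integral, which compensates exactly for the
   quadratic decay in [rectint_local]. *)
have QP n : e0 < 4 ^+ n * nm (Q n (P n)).
  elim: n => [|n IHn].
    by rewrite expr0 mul1r /Q /= expr0 !divr1 /s /t !(addrC _ (_ - _)) !subrK.
  apply: (lt_le_trans IHn); rewrite exprSr -mulrA ler_pM2l ?exprn_gt0 //.
  by have [] := PS n.
(* Chosen so that $e_0(s+t)^2/M\le e_0$; the added 1 covers the degenerate rectangle. *)
pose M := (s + t) ^+ 2 + 1.
have M0 : 0 < M by rewrite ltr_wpDl // sqr_ge0.
have eM : 0 < e0 / M by rewrite divr_gt0.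
have [r r0 hr] := rectint_local px py df eM.
have [N hN] := @geometric_small R (s + t) 2^-1 r ltac:(lra) ltac:(lra) r0.
have stN : s / 2 ^+ N + t / 2 ^+ N = (s + t) * 2^-1 ^+ N.
  by rewrite -mulrDl exprVn.
have := hr _ _ _ _ (hpx N) (hpy N); rewrite !(addrC _ (_ / _)) !addrK stN.
move=> /(_ (hN _ (leqnn _))) hQ.
have := QP N; rewrite /Q !(addrC _ (_ / _)).
apply/negP; rewrite -leNgt.
apply: (@le_trans _ _ (4 ^+ N * (e0 / M * ((s + t) * 2^-1 ^+ N) ^+ 2))).
  by rewrite ler_pM2l // exprn_gt0.
have -> : 4 ^+ N * (e0 / M * ((s + t) * 2^-1 ^+ N) ^+ 2) = e0 / M * (s + t) ^+ 2.
  have : 4 ^+ N * (2^-1 ^+ N) ^+ 2 = 1 :> R.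
    by rewrite -exprM mulnC exprM -exprMn (_ : 4 * 2^-1 ^+ 2 = 1) ?expr1n //; field.
  by rewrite exprMn => h; rewrite mulrCA [4 ^+ N * _]mulrCA h mulr1.
by rewrite -mulrA ler_piMr ?ltW // mulrC ltr_pdivrMr // mul1r /M ltrDl.
Qed.

(** Equal values on the two vertical sides cancel in the contour integral, leaving the horizontal
    ones. *)
Lemma cauchy_shift f (a b c : R) : cdiff f -> a <= b -> 0 <= c ->
  (forall y : R, f (a +i* y) = f (b +i* y)) ->
  cint (fun x => f (x +i* 0)) a b = cint (fun x => f (x +i* c)) a b.
Proof.
move=> df ab c0 per; have := goursat df ab c0.
rewrite /rectint (eq_cint 0 c per) subrr mulr0 addr0.
by move/eqP; rewrite subr_eq0 => /eqP.
Qed.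

End Goursat.

(** * The entire functions $e^{ikw}$ and closure properties of differentiability *)

Section Exponentials.
Variable R : realType.
Implicit Types (z w h : R[i]) (f g : R[i] -> R[i]) (k j : int).
Local Open Scope complex_scope.

Lemma expiD (x y : R) : expi (x + y) = expi x * expi y.
Proof. by apply/eqP; rewrite eq_complex /= cosD sinD eqxx addrC mulrC (mulrC (sin y)) eqxx. Qed.

Lemma expi0 : expi 0 = 1 :> R[i].
Proof. by rewrite /expi cos0 sin0. Qed.

Lemma expi_norm (x : R) : `|expi x| = 1.
Proof. by rewrite normc_def /= cos2Dsin2 sqrtr1. Qed.

Lemma expi_int_period k : expi (k%:~R * (pi *+ 2)) = 1 :> R[i].
Proof.
have nat_case n : expi (n%:R * (pi *+ 2)) = 1 :> R[i].
  elim: n => [|n IHn]; first by rewrite mul0r expi0.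
  rewrite -natr1 mulrDl mul1r expiD IHn mul1r /expi.
  by rewrite -[pi *+ 2]add0r sinD2pi cosD2pi cos0 sin0.
case: k => n; first exact: nat_case.
have := expiD ((Negz n)%:~R * (pi *+ 2)) (n.+1%:R * (pi *+ 2)).
by rewrite nat_case mulr1 NegzE mulrNz mulNr addNr expi0 => <-.
Qed.

(* The function w |-> exp (i k w). *)
Definition Eexp k w : R[i] :=
  (expR (- (k%:~R * complex.Im w)))%:C * expi (k%:~R * complex.Re w).

Lemma EexpD k z w : Eexp k (z + w) = Eexp k z * Eexp k w.
Proof.
rewrite /Eexp; have -> : complex.Im (z + w) = complex.Im z + complex.Im w by case: z w => ? ? [].
have -> : complex.Re (z + w) = complex.Re z + complex.Re w by case: z w => ? ? [].
by rewrite !mulrDr opprD expRD expiD rmorphM mulrACA.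
Qed.

Lemma Eexp_real k (x : R) : Eexp k (x +i* 0) = expi (k%:~R * x).
Proof. by rewrite /Eexp /= mulr0 oppr0 expR0 mul1r. Qed.

Lemma Eexp_im k (y : R) : Eexp k (0 +i* y) = (expR (- (k%:~R * y)))%:C.
Proof. by rewrite /Eexp /= mulr0 expi0 mulr1. Qed.

Lemma Eexp_reim k (x y : R) :
  Eexp k (x +i* y) = expi (k%:~R * x) * (expR (- (k%:~R * y)))%:C.
Proof. by rewrite /Eexp mulrC. Qed.

Lemma Eexp_period k (x y : R) : Eexp k ((x + pi *+ 2) +i* y) = Eexp k (x +i* y).
Proof. by rewrite !Eexp_reim mulrDr expiD expi_int_period mulr1. Qed.

Lemma real_deriv_eps (u : R -> R) (d : R) : is_derive (0 : R) 1 u d ->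
  forall e, 0 < e -> exists2 r, 0 < r & forall x, `|x| < r ->
    `|u x - u 0 - x * d| <= e * `|x|.
Proof.
move=> [du <-] e e0; move: du => /cvgrPdist_lt /(_ e e0) /nbhs_ballP[r r0 hr].
exists r => // x xr; have [->|x0] := eqVneq x 0.
  by rewrite subrr mul0r subrr normr0 mulr0.
have := hr x; rewrite -ball_normE /= sub0r normrN => /(_ xr x0).
rewrite /derive /GRing.scale /= mulr1 addr0 => /ltW h.
have -> : u x - u 0 - x * lim (h0^-1 * (u (h0 * 1 + 0) - u 0) @[h0 --> 0^'])
  = - (x * (lim (h0^-1 * (u (h0 * 1 + 0) - u 0) @[h0 --> 0^']) - x^-1 * (u x - u 0))).
  by rewrite mulrBr mulrA mulfV // mul1r opprB.
by rewrite normrN normrM mulrC ler_wpM2r.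
Qed.

Lemma Eexp_diff0 k : cdiff_at (Eexp k) 0.
Proof.
exists ('i * k%:~R) => e e0.
pose K := `|k%:~R| + 1 : R.
have K0 : 0 < K by rewrite ltr_wpDl.
(* The errors collected at the end are at most $6e'K|h|$. *)
pose e' := Num.min 1 (e / (7 * K)).
have e0' : 0 < e' by rewrite lt_min ltr01 divr_gt0 // mulr_gt0.
have [r1 r10 h1] := real_deriv_eps (is_derive_expR (0 : R)) e0'.
have [r2 r20 h2] := real_deriv_eps (is_derive_cos (0 : R)) e0'.
have [r3 r30 h3] := real_deriv_eps (is_derive_sin (0 : R)) e0'.
(* The bound $e'/2$ yields $|e^a-1|\le e'|a|+|a|\le 2|a|\le e'$. *)
pose r := Num.min (Num.min r1 r2) (Num.min r3 (e' / 2)).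
have r0 : 0 < r by rewrite !lt_min r10 r20 r30 divr_gt0.
exists (r / K); first by rewrite divr_gt0.
move=> h; rewrite ltr_pdivlMr // add0r => hr.
have -> : Eexp k 0 = 1 by rewrite /Eexp /= !mulr0 oppr0 expR0 expi0 mulr1.
set a := - (k%:~R * complex.Im h) : R; set b := k%:~R * complex.Re h : R.
have ale : `|a| <= K * nm h.
  by rewrite normrN normrM ler_pM ?normr_ge0 ?nm_Im // lerDl.
have ble : `|b| <= K * nm h.
  by rewrite normrM ler_pM ?normr_ge0 ?nm_Re // lerDl.
have hK : K * nm h < r by rewrite mulrC.
have -> : Eexp k h - 1 - h * ('i * k%:~R) =
  ((expR a - 1 - a) + expR a * (cos b - 1)) +i*
  (expR a * (sin b - b) + b * (expR a - 1)).
  rewrite /Eexp -/a -/b /expi.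
  have -> : h * ('i * k%:~R) = a +i* b.
    rewrite /a /b; case: (h) => x y /=; rewrite -(rmorph_int (real_complex R)).
    by apply/eqP; rewrite eq_complex /=; apply/andP; split; apply/eqP; ring.
  apply/eqP; rewrite eq_complex /= !mul0r subr0 addr0 subr0; apply/andP.
  by split; apply/eqP; ring.
move: hr hK; set n := nm h in ale ble * => hr hK.
move: (hK); rewrite /r !lt_min => /andP[/andP[k1 k2] /andP[k3 k4]].
have {}h1 := h1 _ (le_lt_trans ale k1); have {}h2 := h2 _ (le_lt_trans ble k2).
have {}h3 := h3 _ (le_lt_trans ble k3).
move: h1 h2 h3; rewrite expR0 cos0 sin0 !mulr1 !subr0 oppr0 mulr0 subr0 => h1 h2 h3.
have e1 : e' <= 1 by rewrite ge_min lexx.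
have b1 : `|expR a - 1| <= e'.
  have := ler_normD (expR a - 1 - a) a; rewrite subrK.
  have : e' * `|a| <= 1 * `|a| by rewrite ler_wpM2r.
  lra.
have b2 : `|expR a| <= 2.
  by have := ler_normD (expR a - 1) 1; rewrite subrK normr1; lra.
have c2 : `|expR a * (cos b - 1)| <= 2 * (e' * `|b|).
  by rewrite normrM ler_pM.
have c3 : `|expR a * (sin b - b)| <= 2 * (e' * `|b|).
  by rewrite normrM ler_pM.
have c4 : `|b * (expR a - 1)| <= `|b| * e'.
  by rewrite normrM ler_wpM2l.
apply: (le_trans (nm_ReIm _ _)).
have := ler_normD (expR a - 1 - a) (expR a * (cos b - 1)).
have := ler_normD (expR a * (sin b - b)) (b * (expR a - 1)).
have ea : e' * `|a| <= e' * (K * n) by rewrite ler_pM2l.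
have eb : e' * `|b| <= e' * (K * n) by rewrite ler_pM2l.
have ec : e' * (K * n) <= e / 7 * n.
  rewrite mulrA; apply: ler_wpM2r; first exact: nm_ge0.
  have : e' <= e / (7 * K) by rewrite ge_min lexx orbT.
  rewrite -(ler_pM2r K0) => /le_trans; apply.
  by rewrite le_eqVlt; apply/orP; left; apply/eqP; field; rewrite gt_eqF.
have n0 : 0 <= n by exact: nm_ge0.
have : `|b| * e' = e' * `|b| by rewrite mulrC.
have : 0 <= e * n by rewrite mulr_ge0 // ltW.
lra.
Qed.

(** The functional equation transports differentiability from 0 to every point. *)
Lemma Eexp_diff k : cdiff (Eexp k).
Proof.
move=> z; have [d hd] := Eexp_diff0 k; exists (Eexp k z * d) => e e0.
have M0 : 0 < nm (Eexp k z) + 1 by rewrite ltr_wpDl // nm_ge0.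
have [r r0 hr] := hd _ (divr_gt0 e0 M0); exists r => // h /hr.
rewrite add0r => h1.
have -> : Eexp k (z + h) - Eexp k z - h * (Eexp k z * d) =
  Eexp k z * (Eexp k h - Eexp k 0 - h * d).
  have -> : Eexp k 0 = 1 by rewrite /Eexp /= !mulr0 oppr0 expR0 expi0 mulr1.
  by rewrite EexpD; ring.
rewrite nmM; apply: (le_trans (ler_wpM2l (nm_ge0 _) h1)).
rewrite mulrA; apply: ler_wpM2r; first exact: nm_ge0.
rewrite mulrCA -[X in _ <= X]mulr1; apply: ler_wpM2l; first exact: ltW.
by rewrite ler_pdivrMr // mul1r lerDl.
Qed.

Lemma cdiffM f g : cdiff f -> cdiff g -> cdiff (fun w => f w * g w).
Proof.
move=> df dg z; have cg := cdiff_cont (dg z).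
have [d hd] := df z; have [d' hd'] := dg z.
exists (d * g z + f z * d') => e e0.
pose M := nm d + nm (g z) + nm (f z) + 2.
have nd := nm_ge0 d; have ng := nm_ge0 (g z); have nf := nm_ge0 (f z).
have M0 : 0 < M by rewrite ltr_wpDl // !addr_ge0.
have e0' : 0 < e / M by rewrite divr_gt0.
pose e' := Num.min 1 (e / M).
have e01 : 0 < e' by rewrite lt_min ltr01.
have [r1 r10 h1] := hd _ e0'; have [r2 r20 h2] := hd' _ e0'; have [r3 r30 h3] := cg _ e01.
exists (Num.min r1 (Num.min r2 r3)); first by rewrite !lt_min r10 r20.
move=> h; rewrite !lt_min => /and3P[/h1 {}h1 /h2 {}h2 /h3 {}h3].
have -> : f (z + h) * g (z + h) - f z * g z - h * (d * g z + f z * d') =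
  (f (z + h) - f z - h * d) * g z + f z * (g (z + h) - g z - h * d')
  + ((f (z + h) - f z - h * d) * (g (z + h) - g z) + h * d * (g (z + h) - g z)) by ring.
set A := f (z + h) - f z - h * d in h1 *.
set B := g (z + h) - g z - h * d' in h2 *.
set D := g (z + h) - g z in h3 *.
have := nmD (A * g z + f z * B) (A * D + h * d * D).
have := nmD (A * g z) (f z * B); have := nmD (A * D) (h * d * D); rewrite !nmM.
have := ler_wpM2r ng h1; have := ler_wpM2l nf h2.
have D1 : nm D <= 1 by move: h3; rewrite lt_min => /andP[/ltW].
have D2 : nm D <= e / M by move: h3; rewrite lt_min => /andP[_ /ltW].
have := ler_wpM2l (nm_ge0 A) D1.
have := ler_wpM2l (mulr_ge0 (nm_ge0 h) nd) D2.
have E : e = e / M * (nm d + nm (g z) + nm (f z) + 2) by rewrite -mulrA mulVf ?mulr1 // gt_eqF.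
rewrite [in X in _ -> _ -> _ -> _ -> _ -> _ -> _ -> _ <= X]E.
have : 0 <= e / M * nm h by rewrite mulr_ge0 ?nm_ge0 // ltW.
set t := e / M in h1 *; set n := nm h in h1 *.
lra.
Qed.

Lemma cdiff_comp_affine f z w : cdiff f -> cdiff (fun x => f (z + w * x)).
Proof.
move=> df x; have [d hd] := df (z + w * x); exists (w * d) => e e0.
have M0 : 0 < nm w + 1 by rewrite ltr_wpDl // nm_ge0.
have [r r0 hr] := hd _ (divr_gt0 e0 M0).
exists (r / (nm w + 1)); first by rewrite divr_gt0.
move=> h; rewrite ltr_pdivlMr // => h1.
have wh : nm (w * h) <= (nm w + 1) * nm h.
  by rewrite nmM ler_wpM2r ?nm_ge0 // lerDl.
have wh' : (nm w + 1) * nm h < r by rewrite mulrC.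
have -> : z + w * (x + h) = z + w * x + w * h by ring.
have -> : h * (w * d) = w * h * d by ring.
move/le_trans: (hr _ (le_lt_trans wh wh')); apply.
by rewrite -mulrA ler_pM2l // ler_pdivrMl.
Qed.

End Exponentials.

(** * Uniqueness of Fourier coefficients *)

Section Fourier.
Variable R : realType.
Implicit Types (f g : R[i] -> R[i]) (k : int).
Local Open Scope complex_scope.

Lemma cos_abs (x : R) : cos `|x| = cos x.
Proof. by case: (ger0P x) => _ //; rewrite cosN. Qed.

Definition ek k (x : R) : R[i] := expi (k%:~R * x).

Lemma ek0 x : ek 0 x = 1.
Proof. by rewrite /ek mul0r expi0. Qed.

Lemma ekD k j x : ek (k + j) x = ek k x * ek j x.
Proof. by rewrite /ek intrD mulrDl expiD. Qed.

Lemma ek_cos x : ek 1 x + ek (- 1) x = 2 * (cos x)%:C.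
Proof.
rewrite /ek mulrNz mulNr mul1r /expi cosN sinN.
by apply/eqP; rewrite eq_complex /=; apply/andP; split; apply/eqP; ring.
Qed.

Lemma ek_Eexp k : ek k =1 (fun x => Eexp k (x +i* 0)).
Proof. by move=> x; rewrite Eexp_real. Qed.

Lemma ek_ccont k : ccont (ek k).
Proof.
have := cdiff_ccont_re 0 (@Eexp_diff R k).
by move=> h x e /(h x)[d d0 hd]; exists d => // y /hd; rewrite !ek_Eexp.
Qed.

(** A nonnegative trigonometric polynomial: it can be tested through Fourier coefficients, and on
    $[-\pi,\pi]$ it peaks only at 0. *)
Definition bump n (x : R) : R := (1 + cos x) ^+ n.

Lemma bump_continuous n : continuous (bump n).
Proof.
move=> x; apply: (@continuous_comp _ _ _ (fun x => 1 + cos x) (fun y => y ^+ n)).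
  by apply: cvgD; [exact: cvg_cst | exact: continuous_cos].
exact: exprn_continuous.
Qed.

(* The weights (1 + cos x)^n concentrate at 0 as n grows. *)
Lemma bump_separates (u : R -> R) : continuous u ->
  (forall n, rint (fun x => u x * bump n x) (- pi) pi = 0) -> u 0 = 0.
Proof.
suff pos (v : R -> R) : continuous v ->
    (forall n, rint (fun x => v x * bump n x) (- pi) pi = 0) -> ~ (0 < v 0).
  move=> cu hu; apply/eqP; rewrite eq_le !leNgt; apply/andP; split; apply/negP.
    exact: pos.
  rewrite -oppr_gt0; apply: (pos (fun x => - u x)).
    by move=> x; apply: cvgN; exact: cu.
  move=> n; have cub : continuous (fun x => u x * bump n x).
    by move=> x; apply: cvgM; [exact: cu | exact: bump_continuous].
  rewrite -[RHS](mulr0 (- 1)) -(hu n) -rintZ //; congr rint; apply/funext => x.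
  by rewrite mulN1r mulNr.
move=> cv hv v0; have p0 := pi_gt0 R; have p2 := pi_ge2 R.
have [eta /andP[eta0 eta1] near0] : exists2 eta : R, 0 < eta <= 1 &
    forall x, `|x| <= eta -> v 0 / 2 <= v x.
  have v2 : 0 < v 0 / 2 by lra.
  have /cvgrPdist_lt := cv 0; move=> /(_ _ v2) /nbhs_ballP[r /= r0 hr]; exists (Num.min 1 (r / 2)).
    by rewrite lt_min ltr01 divr_gt0 //= ge_min lexx.
  move=> x; rewrite le_min => /andP[_ xr].
  have xr2 : `|x| < r by lra.
  have := hr x; rewrite -ball_normE /= sub0r normrN => /(_ xr2).
  by rewrite ltr_norml; lra.
have cosI (x : R) : 0 <= x -> x <= 1 -> x \in `[0, pi].
  by move=> x0 x1; rewrite in_itv /= x0 /=; lra.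
have piI : (pi : R) \in `[0, pi] by rewrite in_itv /= lexx ltW.
(* $1+\cos$ is at most $q$ outside $[-\eta,\eta]$ and at least $q'>q$ on $[-\eta/2,\eta/2]$. The
   vanishing integral then forces $(v(0)/2)q'^n\eta\le 2\pi Mq^n$ for all $n$, which fails for large
   $n$. *)
pose q := 1 + cos eta; pose q' := 1 + cos (eta / 2).
have q0 : 0 < q.
  rewrite /q addrC -ltrBlDr sub0r -cospi ltr_cos //; [lra | by apply: cosI; lra].
have qq' : q < q' by rewrite /q /q' ltrD2l ltr_cos; [lra | apply: cosI; lra..].
have bump_ge0 n x : 0 <= bump n x by rewrite exprn_ge0 //; have := cos_geN1 x; lra.
have [M M0 hM] : exists2 M, 0 < M & forall x, - pi <= x <= pi -> - M <= v x.
  have [|c _ hc] := @EVT_min R v (- pi) pi _ (continuous_subspaceT cv); first by lra.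
  exists (`|v c| + 1); first by rewrite ltr_wpDl.
  move=> x hx; have /hc : x \in `[- pi, pi] by rewrite in_itv.
  by have := ler_norm (- v c); rewrite normrN; lra.
have inner n x : - (eta / 2) <= x <= eta / 2 -> v 0 / 2 * q' ^+ n <= v x * bump n x.
  move=> hx; have ax : `|x| <= eta / 2 by rewrite ler_norml.
  apply: ler_pM; [lra | by rewrite exprn_ge0 //; lra | by apply: near0; lra |].
  apply: lerXn2r; rewrite ?nnegrE; [lra|by have := cos_geN1 x; lra|].
  rewrite lerD2l -[cos x]cos_abs leNgt ltr_cos -?leNgt //; apply: cosI; rewrite ?normr_ge0 //; lra.
have outer n x : - pi <= x <= pi -> - (M * q ^+ n) <= v x * bump n x.
  move=> hx; have [xe|xe] := leP `|x| eta.
    apply: (@le_trans _ _ 0); first by rewrite oppr_le0 mulr_ge0 ?exprn_ge0 ?ltW.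
    by rewrite mulr_ge0 //; have := near0 x xe; lra.
  have bq : bump n x <= q ^+ n.
    apply: lerXn2r; rewrite ?nnegrE; [by have := cos_geN1 x; lra|lra|].
    have xI : `|x| \in `[0, pi] by rewrite in_itv /= normr_ge0 ler_norml.
    have eI : eta \in `[0, pi] by apply: cosI; lra.
    by rewrite lerD2l -(cos_abs x) leNgt (ltr_cos xI eI) -leNgt ltW.
  apply: (@le_trans _ _ (- M * bump n x)).
    by rewrite mulNr lerN2 ler_pM2l.
  by apply: ler_wpM2r => //; exact: hM.
have cst_cont (c : R) : continuous (fun _ : R => c) by move=> x; exact: cvg_cst.
have main n : v 0 / 2 * q' ^+ n * eta <= 2 * pi * M * q ^+ n.
  have cvb : continuous (fun x => v x * bump n x).
    by move=> x; apply: cvgM; [exact: cv | exact: bump_continuous].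
  have l1 : - pi <= - (eta / 2) by lra.
  have l2 : - (eta / 2) <= eta / 2 by lra.
  have l3 : eta / 2 <= pi by lra.
  have := hv n; rewrite (rint_split cvb l1 (le_trans l2 l3)) (rint_split cvb l2 l3).
  have i1 : rint (fun=> - (M * q ^+ n)) (- pi) (- (eta / 2)) <=
      rint (fun x => v x * bump n x) (- pi) (- (eta / 2)).
    by apply: rint_le => // x /andP[? ?]; apply: outer; apply/andP; split; lra.
  have i2 : rint (fun=> v 0 / 2 * q' ^+ n) (- (eta / 2)) (eta / 2) <=
      rint (fun x => v x * bump n x) (- (eta / 2)) (eta / 2).
    by apply: rint_le => // x hx; exact: inner.
  have i3 : rint (fun=> - (M * q ^+ n)) (eta / 2) pi <=
      rint (fun x => v x * bump n x) (eta / 2) pi.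
    by apply: rint_le => // x /andP[? ?]; apply: outer; apply/andP; split; lra.
  move: i1 i2 i3; rewrite (rint_cst _ l1) (rint_cst _ l2) (rint_cst _ l3).
  have : 0 <= M * q ^+ n by rewrite mulr_ge0 ?exprn_ge0 // ltW.
  have -> : 2 * pi * M * q ^+ n = 2 * pi * (M * q ^+ n) by ring.
  move: (M * q ^+ n) (v 0 / 2 * q' ^+ n) => m m' m0 i1 i2 i3 s0.
  have : 0 <= m * eta by rewrite mulr_ge0 // ltW.
  lra.
have q'0 : 0 < q' by lra.
have qr : q / q' < 1 by rewrite ltr_pdivrMr // mul1r.
have qr0 : 0 <= q / q' by rewrite divr_ge0 // ltW.
have [N /(_ N (leqnn _))] := @geometric_small R (2 * pi * M) _ (v 0 / 2 * eta) qr0 qr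
  (mulr_gt0 (divr_gt0 v0 (ltr0n _ 2)) eta0).
rewrite expr_div_n mulrA ltr_pdivrMr ?exprn_gt0 // [v 0 / 2 * eta * _]mulrAC.
by rewrite ltNge main.
Qed.

(** Multiplication by $1+\cos x$ combines the frequencies $k-1$, $k$ and $k+1$, so by induction all
    coefficients of $g$ times [bump n] vanish. Real and imaginary parts are then separated because
    the weight is real. *)
Lemma fourier_unique (g : R -> R[i]) : ccont g ->
  (forall k, cint (fun x => g x * ek k x) (- pi) pi = 0) -> g 0 = 0.
Proof.
move=> cg hg.
have cb n : ccont (fun x => (bump n x)%:C).
  move=> x e e0; have /cvgrPdist_lt /(_ e e0) /nbhs_ballP[r r0 hr] := @bump_continuous n x.
  exists r => // y yr; rewrite -rmorphB nmR distrC; apply: hr.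
  by rewrite -ball_normE /= distrC.
have key n k : cint (fun x => g x * (bump n x)%:C * ek k x) (- pi) pi = 0.
  elim: n k => [|n IHn] k.
    rewrite -(hg k); apply: eq_cint => x.
    by rewrite /bump expr0 mulr1.
  pose G j x := g x * (bump n x)%:C * ek j x.
  have cG j : ccont (G j) by apply: ccontM (ek_ccont j); exact: ccontM.
  have -> : cint (fun x => g x * (bump n.+1 x)%:C * ek k x) (- pi) pi =
    cint (fun x => G k x + 2^-1 * (G (k + 1) x + G (k - 1) x)) (- pi) pi.
    apply: eq_cint => x; rewrite /G !ekD.
    have -> : (bump n.+1 x)%:C = (bump n x)%:C * (1 + 2^-1 * (ek 1 x + ek (- 1) x)).
      rewrite ek_cos mulrA mulVf ?mul1r ?pnatr_eq0 //.
      by rewrite -(rmorph1 (real_complex R)) -rmorphD -rmorphM -exprSr.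
    by ring.
  rewrite cintD ?cintZ ?cintD //; first by rewrite !IHn addr0 mulr0 addr0.
    exact: ccontD.
  by apply: ccontM; [exact: ccont_cst | exact: ccontD].
have part n : cint (fun x => g x * (bump n x)%:C) (- pi) pi = 0.
  by rewrite -(key n 0); apply: eq_cint => x; rewrite ek0 mulr1.
have ReM (z : R[i]) (r : R) : complex.Re (z * r%:C) = complex.Re z * r.
  by case: z => x y /=; rewrite mulr0 subr0.
have ImM (z : R[i]) (r : R) : complex.Im (z * r%:C) = complex.Im z * r.
  by case: z => x y /=; rewrite mulr0 add0r.
apply/eqP; rewrite eq_complex /=; apply/andP; split; apply/eqP.
- apply: (bump_separates (ccont_Re cg)) => n.
  have [<- _] := part n; congr rint; apply/funext => x; exact/esym/ReM.
- apply: (bump_separates (ccont_Im cg)) => n.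
  have [_ <-] := part n; congr rint; apply/funext => x; exact/esym/ImM.
Qed.

End Fourier.

(** * Identity theorem and comparison of two horizontal lines *)

Section Entire.
Variable R : realType.
Implicit Types (f g : R[i] -> R[i]) (k : int).
Local Open Scope complex_scope.

(* Extending f by 0 below the real axis keeps it complex differentiable. The
   product of four rotated copies about i then has support in a square, so all
   its Fourier coefficients vanish. *)
Lemma entire_real_zero_i f : cdiff f -> (forall t : R, f (t%:C) = 0) -> f 'i = 0.
Proof.
move=> df f0.
pose f1 w := if 0 < complex.Im w then f w else 0.
have df1 : cdiff f1.
  move=> [x y]; have [y0|y0|y0] := ltgtP 0 y.
  - have [d hd] := df (x +i* y); exists d => e e0; have [r r0 hr] := hd e e0.
    exists (Num.min r y); first by rewrite lt_min r0.
    move=> h; rewrite lt_min => /andP[/hr]; rewrite /f1 /= y0 => {}hr hy.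
    suff -> : 0 < complex.Im (x +i* y + h) by [].
    have := nm_Im h; case: h hy {hr} => a b /= hy hb.
    by have := ler_norm (- b); rewrite normrN; lra.
  - exists 0 => e e0; exists (- y); first by rewrite oppr_gt0.
    move=> [a b] hy; rewrite /f1 /= !ltNge (ltW y0) /=.
    have -> : y + b <= 0 by have := nm_Im (a +i* b); have /= := ler_norm b; lra.
    by rewrite mulr0 subrr subr0 nm0 mulr_ge0 ?nm_ge0 // ltW.
  (* At a real point the increments along the real line show that the derivative of [f] is 0, so
     gluing with 0 below is differentiable. *)
  - rewrite -y0; exists 0 => e e0; have [d hd] := df (x%:C).
    have d0 : d = 0.
      apply: nm_small0 => e' e0'; have [r r0 hr] := hd e' e0'.
      have := hr (r / 2)%:C; rewrite nmR ger0_norm; last by lra.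
      move=> /(_ ltac:(lra)); rewrite -rmorphD !f0 subrr sub0r nmN nmM nmR ger0_norm; last by lra.
      by rewrite mulrC ler_pM2r //; lra.
    have [r r0 hr] := hd e e0; exists r => // h /hr.
    rewrite d0 mulr0 !subr0 f0 subr0 /f1 /= ltxx subr0 => h1.
    by case: ifP => // _; rewrite nm0 mulr_ge0 ?nm_ge0 // ltW.
(* The imaginary parts of the four arguments are $1+y$, $1+x$, $1-y$ and $1-x$ for $w=x+iy$, so $g$
   vanishes outside the open unit square; at $w=0$ it is $f_1(i)^4$. *)
pose g w := f1 ('i + 1 * w) * f1 ('i + 'i * w) * f1 ('i + (- 1) * w) * f1 ('i + (- 'i) * w).
have dg : cdiff g.
  by do 3!(apply: cdiffM; last exact: cdiff_comp_affine); exact: cdiff_comp_affine.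
have f1_out w : complex.Im w <= 0 -> f1 w = 0 by rewrite /f1 ltNge => ->.
have gsup x y : (1 <= `|x|) || (1 <= `|y|) -> g (x +i* y) = 0.
  rewrite /g !ler_normr => /orP[|] /orP[|] h.
  - rewrite (f1_out ('i + (- 'i) * _)) ?mulr0 //=; lra.
  - rewrite (f1_out ('i + 'i * _)) ?(mul0r, mulr0) //=; lra.
  - rewrite (f1_out ('i + (- 1) * _)) ?(mul0r, mulr0) //=; lra.
  - rewrite (f1_out ('i + 1 * _)) ?(mul0r, mulr0) //=; lra.
have p2 := pi_ge2 R.
have g0 : g (0 +i* 0) = 0.
  apply: (fourier_unique (cdiff_ccont_re 0 dg)) => k.
  have dG : cdiff (fun w => g w * Eexp k w) by apply: cdiffM dg _; exact: Eexp_diff.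
  (* At height 2 the product vanishes, and on the vertical sides too since $\pi\ge 2$. *)
  have := @cauchy_shift R _ (- pi) pi 2 dG ltac:(lra) ltac:(lra) _.
  rewrite (eq_cint _ _ (g := fun x => g (x +i* 0) * ek k x)); last by move=> x; rewrite Eexp_real.
  move=> ->; last first.
    move=> y; rewrite !gsup ?mul0r //.
      by rewrite ger0_norm; lra.
    by rewrite normrN ger0_norm; lra.
  rewrite (eq_cint _ _ (g := fun=> 0)); first by rewrite cint_cst ?mul0r //; lra.
  by move=> x; rewrite gsup ?mul0r // (ger0_norm (_ : 0 <= 2)) ?orbT //; lra.
move: g0; rewrite /g (_ : 0 +i* 0 = 0) // !mulr0 addr0 => /eqP.
by rewrite !mulf_eq0 !orbb /f1 /= ltr01 => /eqP.
Qed.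

(** For real $u$ and $y$ the substitution $w\mapsto u+yw$ preserves the real line and sends $i$ to
    $u+iy$. *)
Lemma entire_real_zero f : cdiff f -> (forall t : R, f (t%:C) = 0) -> forall z, f z = 0.
Proof.
move=> df f0 [u y].
have := @entire_real_zero_i (fun w => f (u%:C + y%:C * w)).
rewrite mulrC -complexRI; apply; first exact: cdiff_comp_affine.
by move=> t; rewrite -rmorphM -rmorphD f0.
Qed.

(** The identity theorem for $Q(w+2\pi)-Q(w)$ gives periodicity on the vertical sides. On the line
    of height $\beta$ the factor $e^{ikw}$ contributes $e^{-k\beta}$, which cancels the weight in
    the hypothesis. *)
Lemma fourier_shift (P : R -> R[i]) (Q : R[i] -> R[i]) (beta : R) : 0 <= beta ->
  ccont P -> cdiff Q -> (forall t : R, Q ((t + pi *+ 2)%:C) = Q t%:C) ->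
  (forall k, cint (fun x => P x * ek k x) (- pi) pi =
     (expR (k%:~R * beta))%:C * cint (fun x => Q (x%:C) * ek k x) (- pi) pi) ->
  P 0 = Q (0 +i* beta).
Proof.
move=> b0 cP dQ perQ coef.
have per w : Q (w + (pi *+ 2)%:C) = Q w.
  apply/eqP; rewrite -subr_eq0; apply/eqP.
  apply: (@entire_real_zero (fun w => Q (w + (pi *+ 2)%:C) - Q w)).
    apply: cdiffB => //.
    have := @cdiff_comp_affine R Q ((pi *+ 2)%:C) 1 dQ.
    rewrite (_ : (fun x => _) = (fun w => Q (w + (pi *+ 2)%:C))) //.
    by apply/funext => x; rewrite mul1r addrC.
  by move=> t; rewrite -rmorphD perQ subrr.
have p2 := pi_ge2 R.
apply/eqP; rewrite -subr_eq0; apply/eqP.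
have cQ y : ccont (fun x => Q (x +i* y)) by exact: cdiff_ccont_re.
apply: (fourier_unique (g := fun x => P x - Q (x +i* beta))); first exact: ccontB.
move=> k; have ck := @ek_ccont R k.
rewrite (eq_cint _ _ (g := fun x => P x * ek k x - Q (x +i* beta) * ek k x));
  last by move=> x; rewrite mulrBl.
rewrite cintB; [|exact: ccontM..].
rewrite coef.
have dG : cdiff (fun w => Q w * Eexp k w) by apply: cdiffM dQ _; exact: Eexp_diff.
have := @cauchy_shift R _ (- pi) pi beta dG ltac:(lra) b0 _.
have -> : cint (fun x => Q (x +i* 0) * Eexp k (x +i* 0)) (- pi) pi =
   cint (fun x => Q x%:C * ek k x) (- pi) pi.
  by apply: eq_cint => x; rewrite Eexp_real.
move=> ->; last first.
  move=> y; have -> : pi +i* y = (- pi + pi *+ 2) +i* y.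
    by congr (_ +i* _); rewrite mulr2n; ring.
  rewrite Eexp_period; congr (_ * _).
  have -> : (- pi + pi *+ 2) +i* y = (- pi +i* y) + (pi *+ 2)%:C.
    by apply/eqP; rewrite eq_complex /= addr0 !eqxx.
  by rewrite per.
rewrite -cintZ; last first.
  by apply: (@ccontM _ (fun x => Q (x +i* beta)) (fun x => Eexp k (x +i* beta)));
    [exact: cQ | exact: cdiff_ccont_re (@Eexp_diff R k)].
rewrite (eq_cint _ _ (f := fun x => _%:C * _) (g := fun x => Q (x +i* beta) * ek k x)) ?subrr //.
move=> x; rewrite Eexp_reim /ek mulrCA; congr (_ * _).
by rewrite mulrCA -rmorphM -expRD subrr expR0 mulr1.
Qed.

End Entire.

(** * Representations and the gauge action *)

Section Representations.
Variables (R : realType) (A : cstarAlgType R) (X : corrType A) (C : cstarAlgType R).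
Variables (psi : {linear X -> C}) (pi : {linear A -> C}).
Hypothesis rep : is_representation psi pi.

Lemma bounded_linear (V W : normedModType R[i]) (f : {linear V -> W}) (M : R) :
  (forall v, nm (f v) <= M * nm v) -> bounded_additive f.
Proof. by move=> h; split; [exact: linearB | exists M]. Qed.

Lemma rep_pi_mul a b : pi (a ** b) = pi a ** pi b.
Proof. by have [h _] := rep_hom rep; exact: h. Qed.

Lemma rep_pi_star a : pi (cstar a) = cstar (pi a).
Proof. by have [_ h] := rep_hom rep; exact: h. Qed.

(** $|\psi(x)|^2=|\pi(\langle x,x\rangle)|\le|\langle x,x\rangle|=|x|^2$. *)
Lemma rep_bounded : bounded_additive psi.
Proof.
apply: (@bounded_linear _ _ _ 1) => x; rewrite mul1r.
rewrite -(@ler_pXn2r _ 2) // ?nnegrE ?nm_ge0 // -nm_cstar_mul -(rep_inner rep).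
by rewrite -nm_inner; exact: star_hom_contraction (rep_hom rep) _.
Qed.

(** The difference $D$ of the two sides satisfies $D^*D=0$, because $D^*D$ expands into values of
    $\pi$ at inner products that cancel. *)
Lemma rep_ract x b : psi (ract x b) = psi x ** pi b.
Proof.
apply/eqP; rewrite -subr_eq0; apply/eqP; apply: cstar_mul_eq0.
rewrite cstarB cstarM -rep_pi_star cmulBl !cmulBr !cmulA -(rep_inner rep).
rewrite -(cmulA (pi (cstar b)) (cstar (psi x))) -(cmulA (pi (cstar b)) (cstar (psi x)) (psi x)).
rewrite -!(rep_inner rep) -!rep_pi_mul inner_ractl !inner_ract !inner_ractl cmulA.
by rewrite !subrr.
Qed.

Lemma rep_approx x (e : R) : 0 < e -> exists c, nm (psi x - psi x ** pi c) < e.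
Proof.
move=> e0; have [M M0 hM] := bounded_pos rep_bounded.
have [c hc] := approximate_unit x (divr_gt0 e0 M0); exists c.
rewrite -rep_ract -linearB (le_lt_trans (hM _)) // mulrC.
by rewrite -ltr_pdivlMr.
Qed.

(** The access to a lone $\psi(x)$: after multiplication by $\pi(c)$ it becomes a monomial with
    right factor of degree 0. *)
Lemma rep_approx_lim (E : C -> Prop) x : lim_closed E ->
  (forall c, E (psi x ** pi c)) -> E (psi x).
Proof.
by move=> cE h; apply: cE => e /(rep_approx x)[c hc]; exists (psi x ** pi c).
Qed.

(* D = psi (a x) - pi a ** psi x kills pi A on the right, hence also
   (psi X)^* because X A is dense in X; so D D^* = 0. *)
Lemma rep_lact a x : psi (lact a x) = pi a ** psi x.
Proof.
apply/eqP; rewrite -subr_eq0; apply/eqP; rewrite -[LHS]cstarK.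
set D := psi (lact a x) - pi a ** psi x.
have D0 b : D ** pi b = 0.
  by rewrite cmulBl -rep_ract (rep_bimod rep) subrr.
have Dz z : D ** cstar (psi z) = 0.
  apply: (rep_approx_lim (E := fun t => D ** cstar t = 0)).
    apply: lim_closed_preim (@lim_closed0 _ _).
    exact: bounded_comp (bounded_cmull D) (bounded_cstar C).
  by move=> c; rewrite cstarM -rep_pi_star cmulA D0 cmul0l.
suff -> : cstar D = 0 by rewrite cstar0.
apply: cstar_mul_eq0; rewrite cstarK {2}/D cstarB cstarM cmulBr cmulA !Dz cmul0l.
by rewrite subrr.
Qed.

End Representations.

(** * Products in the Toeplitz algebra *)

Section Toeplitz.
Variables (R : realType) (A : cstarAlgType R) (X : corrType A).
Variables (XX : tensor_powers X) (T : cstarAlgType R).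
Variables (psi : {linear X -> T}) (pi : {linear A -> T}).
Variable Psi : forall m : nat, {linear tpow XX m -> T}.
Hypothesis hPsi : is_induced_rep psi pi Psi.
Implicit Types (s t : T).

(** The dense set in [tensor_dense] consists of plain sums, scalars being absorbed in the factors,
    so additivity and closedness suffice. *)
Lemma tpow_ind k (E : tpow XX k.+2 -> Prop) : E 0 ->
  (forall u v, E u -> E v -> E (u + v)) -> lim_closed E ->
  (forall x xi, E (tcons x xi)) -> forall u, E u.
Proof.
move=> E0 ED cE Et u; apply: cE => e e0.
have [d [n [x [y ->]]] hd] := dense_approx (tensor_dense (@tp_spec _ _ _ XX k)) u e0.
by eexists; last exact: hd; apply: (big_ind E) => // i _; exact: Et.
Qed.

Lemma Psi_bounded m : bounded_additive (Psi m).
Proof. exact: rep_bounded (induced_rep hPsi m). Qed.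

Lemma psi_rep : is_representation psi pi.
Proof.
have h := induced_rep hPsi 1%N; split; first exact: rep_hom h.
  by move=> a x b; rewrite -!(induced1 hPsi); exact: (rep_bimod h).
by move=> x y; rewrite -!(induced1 hPsi); exact: (rep_inner h).
Qed.

(** The closure of the range of [Psi m], where products computed on elementary tensors end up after
    passing to limits. *)
Definition cl_range m t := forall e : R, 0 < e -> exists w, nm (t - Psi m w) < e.

Lemma cl_range_Psi m w : cl_range m (Psi m w).
Proof. by move=> e e0; exists w; rewrite subrr nm0. Qed.

Lemma cl_range_lim m : lim_closed (cl_range m).
Proof.
move=> t ht e e0; have e2 : 0 < e / 2 by rewrite divr_gt0.
have [d /(_ _ e2)[w hw] hd] := ht _ e2; exists w.
by rewrite (le_lt_trans (nm_dist d _ _)) // [e]splitr ltrD.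
Qed.

Lemma cl_range0 m : cl_range m 0.
Proof. by rewrite -(linear0 (Psi m)); exact: cl_range_Psi. Qed.

Lemma cl_rangeD m s t : cl_range m s -> cl_range m t -> cl_range m (s + t).
Proof.
move=> hs ht e e0; have e2 : 0 < e / 2 by rewrite divr_gt0.
have [w hw] := hs _ e2; have [w' hw'] := ht _ e2; exists (w + w').
by rewrite linearD opprD addrACA (le_lt_trans (nmD _ _)) // [e]splitr ltrD.
Qed.

Lemma cl_range_ind m (E : T -> Prop) : lim_closed E ->
  (forall w, E (Psi m w)) -> forall t, cl_range m t -> E t.
Proof. by move=> cE h t ht; apply: cE => e /ht[w hw]; exists (Psi m w). Qed.

Lemma psi_Psi x m (u : tpow XX m) : exists w, psi x ** Psi m u = Psi m.+1 w.
Proof.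
case: m u => [|m] u.
  exists (ract x (u : A)); rewrite (induced0 hPsi) (induced1 hPsi).
  by rewrite (rep_ract psi_rep).
by exists (tcons x u); rewrite (induced_tcons hPsi).
Qed.

(** On $y\otimes\xi$ the two leading factors merge into $\pi(\langle x,y\rangle)$, which the left
    action absorbs into $\xi$. *)
Lemma psi_star_Psi x m (u : tpow XX m.+1) : cl_range m (cstar (psi x) ** Psi m.+1 u).
Proof.
case: m u => [|m] u.
  rewrite (induced1 hPsi) -(rep_inner psi_rep) -(induced0 hPsi).
  exact: cl_range_Psi.
pattern u; apply: tpow_ind => {u}.
- by rewrite linear0 cmul0r; exact: cl_range0.
- by move=> u v hu hv; rewrite linearD cmulDr; exact: cl_rangeD.
- apply: lim_closed_preim; last exact: cl_range_lim.
  exact: bounded_comp (bounded_cmull _) (Psi_bounded _).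
- move=> y xi; rewrite (induced_tcons hPsi) cmulA -(rep_inner psi_rep).
  by rewrite -(rep_lact (induced_rep hPsi m.+1)); exact: cl_range_Psi.
Qed.

(** Tensor powers grow on the left, so appending a factor on the right takes an induction that peels
    off leading factors. *)
Lemma Psi_psi m (u : tpow XX m) z : cl_range m.+1 (Psi m u ** psi z).
Proof.
elim: m u => [|m IHm] u.
  rewrite (induced0 hPsi) -(rep_lact psi_rep) -(induced1 hPsi).
  exact: cl_range_Psi.
case: m u IHm => [|m] u IHm.
  rewrite (induced1 hPsi); have -> : psi z = Psi 1%N z by rewrite (induced1 hPsi).
  by rewrite -(induced_tcons hPsi); exact: cl_range_Psi.
pattern u; apply: tpow_ind => {u}.
- by rewrite linear0 cmul0l; exact: cl_range0.
- by move=> u v hu hv; rewrite linearD cmulDl; exact: cl_rangeD.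
- apply: lim_closed_preim; last exact: cl_range_lim.
  exact: bounded_comp (bounded_cmulr _) (Psi_bounded _).
- move=> y xi; rewrite (induced_tcons hPsi) -cmulA.
  apply: (cl_range_ind (m := m.+2) (E := fun t => cl_range m.+3 (psi y ** t))) (IHm xi).
    apply: lim_closed_preim; last exact: cl_range_lim.
    exact: bounded_cmull.
  by move=> w; rewrite -(induced_tcons hPsi); exact: cl_range_Psi.
Qed.

Lemma Psi_pi_star m (u : tpow XX m) c :
  Psi m u ** pi c = Psi m u ** cstar (Psi 0%N (cstar c)).
Proof. by rewrite (induced0 hPsi) (rep_pi_star psi_rep) cstarK. Qed.

Lemma pi_star_Psi m (u : tpow XX m) c :
  cstar (Psi m u ** pi c) = Psi 0%N (cstar c) ** cstar (Psi m u).
Proof. by rewrite (induced0 hPsi) (rep_pi_star psi_rep) cstarM. Qed.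

(** * The monomials span a dense subspace *)

Section Density.

(** The closed additive span, encoded as the intersection of all closed additive properties of the
    monomials, so that membership is an induction principle. *)
Definition mono_span t := forall E : T -> Prop, E 0 ->
  (forall a b, E a -> E b -> E (a + b)) -> lim_closed E ->
  (forall l m (x : tpow XX l) (y : tpow XX m), E (Psi l x ** cstar (Psi m y))) -> E t.

Lemma mono_span_mono l m (x : tpow XX l) (y : tpow XX m) :
  mono_span (Psi l x ** cstar (Psi m y)).
Proof. by move=> E _ _ _; apply. Qed.

Lemma mono_span0 : mono_span 0.
Proof. by []. Qed.

Lemma mono_spanD s t : mono_span s -> mono_span t -> mono_span (s + t).
Proof.
move=> hs ht E E0 ED cE Em.
by apply: (ED); [exact: (hs E E0 ED cE Em) | exact: (ht E E0 ED cE Em)].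
Qed.

Lemma mono_span_lim : lim_closed mono_span.
Proof.
move=> t ht E E0 ED cE Em; apply: (cE) => e /ht[d hd td].
by exists d => //; exact: hd.
Qed.

Lemma mono_span_preim (f : T -> T) : f 0 = 0 ->
  (forall a b, f (a + b) = f a + f b) -> bounded_additive f ->
  (forall l m (x : tpow XX l) (y : tpow XX m), mono_span (f (Psi l x ** cstar (Psi m y)))) ->
  forall t, mono_span t -> mono_span (f t).
Proof.
move=> f0 fD bf fm t ht; apply: (ht (fun t => mono_span (f t))) => //.
- by rewrite f0; exact: mono_span0.
- by move=> a b ha hb; rewrite fD; exact: mono_spanD.
- exact: lim_closed_preim bf mono_span_lim.
Qed.

Lemma mono_spanZ k t : mono_span t -> mono_span (k *: t).
Proof.
apply: mono_span_preim => [|a b||l m x y]; first exact: scaler0.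
- exact: scalerDr.
- exact: bounded_scale (bounded_id T).
- by rewrite -cmulZl -linearZ; exact: mono_span_mono.
Qed.

Lemma mono_span_Psi m (u : tpow XX m) : mono_span (Psi m u).
Proof.
apply: (rep_approx_lim (induced_rep hPsi m)); first exact: mono_span_lim.
by move=> c; rewrite Psi_pi_star; exact: mono_span_mono.
Qed.

Lemma mono_span_Psi_star m (u : tpow XX m) : mono_span (cstar (Psi m u)).
Proof.
apply: (rep_approx_lim (induced_rep hPsi m) (E := fun t => mono_span (cstar t))).
  exact: lim_closed_preim (bounded_cstar T) mono_span_lim.
by move=> c; rewrite pi_star_Psi; exact: mono_span_mono.
Qed.

Lemma mono_span_mull s : (forall l m (x : tpow XX l) (y : tpow XX m),
    mono_span (s ** (Psi l x ** cstar (Psi m y)))) ->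
  forall t, mono_span t -> mono_span (s ** t).
Proof.
apply: mono_span_preim; first exact: cmul0r.
- by move=> a b; rewrite cmulDr.
- exact: bounded_cmull.
Qed.

Lemma mono_span_psi x t : mono_span t -> mono_span (psi x ** t).
Proof.
apply: mono_span_mull => l m u y; rewrite cmulA.
by have [w ->] := psi_Psi x u; exact: mono_span_mono.
Qed.

Lemma mono_span_pi a t : mono_span t -> mono_span (pi a ** t).
Proof.
apply: mono_span_mull => l m u y; rewrite cmulA.
by rewrite -(rep_lact (induced_rep hPsi l)); exact: mono_span_mono.
Qed.

Lemma mono_span_psi_star x t : mono_span t -> mono_span (cstar (psi x) ** t).
Proof.
apply: mono_span_mull => l m u y; rewrite cmulA.
case: l u => [|l] u.
  (* With no factor on the left to cancel, the product is the adjoint of an element of degree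
     $m+1$. *)
  have -> : cstar (psi x) ** Psi 0%N u ** cstar (Psi m y) =
      cstar (Psi m y ** psi (lact (cstar (u : A)) x)).
    by rewrite (rep_lact psi_rep) (rep_pi_star psi_rep) !cstarM cstarK (induced0 hPsi).
  apply: (cl_range_ind (m := m.+1) (E := fun t => mono_span (cstar t))) (Psi_psi y _).
    exact: lim_closed_preim (bounded_cstar T) mono_span_lim.
  by move=> w; exact: mono_span_Psi_star.
apply: (cl_range_ind (m := l) (E := fun t => mono_span (t ** cstar (Psi m y)))) (psi_star_Psi x u).
  exact: lim_closed_preim (bounded_cmulr _) mono_span_lim.
by move=> w; exact: mono_span_mono.
Qed.

Hypothesis hgen : generates (range psi `|` range pi).

Lemma mono_spanT t : mono_span t.
Proof.
(* Requiring that $t$ and $t^*$ multiply the span into itself makes [D] stable under products; only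
   generators then have to be multiplied with monomials. *)
pose D : set T := [set t | [/\ mono_span t, mono_span (cstar t),
  forall v, mono_span v -> mono_span (t ** v) &
  forall v, mono_span v -> mono_span (cstar t ** v)]].
suff DT : D = setT by have [] : D t by rewrite DT.
apply: hgen; last first.
- move=> _ [[x _ <-]|[a _ <-]].
    split; [| |exact: mono_span_psi|exact: mono_span_psi_star].
      by have := mono_span_Psi (m := 1) x; rewrite (induced1 hPsi).
    by have := mono_span_Psi_star (m := 1) x; rewrite (induced1 hPsi).
  split; [| |exact: mono_span_pi|].
  + by have := mono_span_Psi (m := 0) a; rewrite (induced0 hPsi).
  + by have := mono_span_Psi_star (m := 0) a; rewrite (induced0 hPsi).
  + by rewrite -(rep_pi_star psi_rep); exact: mono_span_pi.
- apply: lim_closed_closed => d hd.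
  have L (E : T -> Prop) : lim_closed E -> (forall c, D c -> E c) -> E d.
    by move=> cE h; apply: cE => e /hd[c /h Ec ?]; exists c.
  split.
  + by apply: L mono_span_lim _ => c [].
  + apply: (L (fun c => mono_span (cstar c))) => [|c []//].
    exact: lim_closed_preim (bounded_cstar T) mono_span_lim.
  + move=> v hv; apply: (L (fun c => mono_span (c ** v))) => [|c [_ _ h _]]; last exact: h.
    exact: lim_closed_preim (bounded_cmulr v) mono_span_lim.
  + move=> v hv; apply: (L (fun c => mono_span (cstar c ** v))) => [|c [_ _ _ h]]; last exact: h.
    apply: lim_closed_preim mono_span_lim.
    exact: bounded_comp (bounded_cmulr v) (bounded_cstar T).
- split.
  + split; rewrite ?cstar0; do ?exact: mono_span0.
      by move=> v _; rewrite cmul0l; exact: mono_span0.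
    by move=> v _; rewrite cmul0l; exact: mono_span0.
  + move=> k a b [a1 a2 a3 a4] [b1 b2 b3 b4]; split.
    * by apply: mono_spanD => //; exact: mono_spanZ.
    * by rewrite cstarP; apply: mono_spanD => //; exact: mono_spanZ.
    * move=> v hv; rewrite cmulPl; apply: mono_spanD; last exact: b3.
      by apply: mono_spanZ; exact: a3.
    * move=> v hv; rewrite cstarP cmulPl; apply: mono_spanD; last exact: b4.
      by apply: mono_spanZ; exact: a4.
  + move=> a b [a1 a2 a3 a4] [b1 b2 b3 b4]; split.
    * exact: a3.
    * by rewrite cstarM; exact: b4.
    * by move=> v hv; rewrite -cmulA; apply: a3; exact: b3.
    * by move=> v hv; rewrite cstarM -cmulA; apply: b4; exact: a4.
  + by move=> a [a1 a2 a3 a4]; split; rewrite ?cstarK.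
Qed.

Lemma mono_ind (E : T -> Prop) : E 0 -> (forall a b, E a -> E b -> E (a + b)) ->
  lim_closed E ->
  (forall l m (x : tpow XX l) (y : tpow XX m), E (Psi l x ** cstar (Psi m y))) ->
  forall t, E t.
Proof. by move=> E0 ED cE Em t; exact: (mono_spanT t). Qed.

End Density.

(** * Gauge degrees and continuity of orbits *)

Section Gauge.
Variable gamma : R[i] -> {linear T -> T}.
Hypothesis hgamma : is_gauge_action psi pi gamma.

Lemma gauge_hom (t : R) : is_star_hom (gamma (expi t)).
Proof. by apply: (circle_hom (gauge_action hgamma)); exact: expi_norm. Qed.

Lemma gauge_contraction (r : R) t : nm (gamma (expi r) t) <= nm t.
Proof. exact: star_hom_contraction (gauge_hom r) t. Qed.

Lemma gauge_bounded (r : R) : bounded_additive (gamma (expi r)).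
Proof.
by apply: (@bounded_linear _ _ _ _ 1) => t; rewrite mul1r gauge_contraction.
Qed.

Definition gauge_degree (k : int) t := forall r : R, gamma (expi r) t = ek k r *: t.

Lemma gauge_degreeM j k s t : gauge_degree j s -> gauge_degree k t ->
  gauge_degree (j + k) (s ** t).
Proof.
move=> hs ht r; have [h _] := gauge_hom r.
by rewrite h hs ht ekD cmulZl cmulZr scalerA.
Qed.

Lemma gauge_degree_star k t : gauge_degree k t -> gauge_degree (- k) (cstar t).
Proof.
move=> ht r; have [_ h] := gauge_hom r.
rewrite h ht cstarZ; congr (_ *: _).
by rewrite /ek mulrNz mulNr /expi cosN sinN.
Qed.

Lemma gauge_degree_pi a : gauge_degree 0 (pi a).
Proof.
by move=> r; rewrite (gauge_pi hgamma) ?expi_norm // ek0 scale1r.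
Qed.

Lemma gauge_degree_psi x : gauge_degree 1 (psi x).
Proof.
by move=> r; rewrite (gauge_psi hgamma) ?expi_norm // /ek mul1r.
Qed.

Lemma gauge_degree0 k : gauge_degree k 0.
Proof. by move=> r; rewrite linear0 scaler0. Qed.

Lemma gauge_degreeD k s t : gauge_degree k s -> gauge_degree k t ->
  gauge_degree k (s + t).
Proof. by move=> hs ht r; rewrite linearD hs ht scalerDr. Qed.

Lemma gauge_degree_lim k : lim_closed (gauge_degree k).
Proof.
apply: lim_closed_forall => r; apply: lim_closed_eq; first exact: gauge_bounded.
exact: bounded_scale (bounded_id T).
Qed.

Lemma gauge_degree_Psi m (u : tpow XX m) : gauge_degree m%:Z (Psi m u).
Proof.
elim: m u => [|m IHm] u; first by rewrite (induced0 hPsi); exact: gauge_degree_pi.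
case: m u IHm => [|m] u IHm; first by rewrite (induced1 hPsi); exact: gauge_degree_psi.
pattern u; apply: tpow_ind => {u}.
- by rewrite linear0; exact: gauge_degree0.
- by move=> u v hu hv; rewrite linearD; exact: gauge_degreeD.
- by apply: lim_closed_preim (Psi_bounded _) _; exact: gauge_degree_lim.
- move=> x xi; rewrite (induced_tcons hPsi).
  by rewrite intS; apply: gauge_degreeM; [exact: gauge_degree_psi | exact: IHm].
Qed.

Lemma gauge_degree_mono l m (x : tpow XX l) (y : tpow XX m) :
  gauge_degree (l%:Z - m%:Z) (Psi l x ** cstar (Psi m y)).
Proof.
by apply: gauge_degreeM; [|apply: gauge_degree_star]; exact: gauge_degree_Psi.
Qed.

(** The orbit of a monomial is a scalar exponential times a fixed element, and contractivity of the
    action carries continuity to limits. *)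
Lemma gauge_continuous : generates (range psi `|` range pi) ->
  forall t (r e : R), 0 < e -> exists2 d : R, 0 < d &
    forall r', `|r' - r| < d -> nm (gamma (expi r') t - gamma (expi r) t) < e.
Proof.
move=> hgen; apply: (mono_ind hgen).
- move=> r e e0; exists 1 => // r' _.
  by rewrite (linear0 (gamma (expi r'))) (linear0 (gamma (expi r))) subrr nm0.
- move=> a b ha hb r e e0; have e2 : 0 < e / 2 by rewrite divr_gt0.
  have [d d0 hd] := ha r _ e2; have [d' d0' hd'] := hb r _ e2.
  exists (Num.min d d'); first by rewrite lt_min d0.
  move=> r'; rewrite lt_min => /andP[/hd h /hd' h'].
  rewrite (linearD (gamma (expi r'))) (linearD (gamma (expi r))) opprD addrACA.
  by rewrite (le_lt_trans (nmD _ _)) // [e]splitr ltrD.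
- move=> a ha r e e0; have e3 : 0 < e / 3 by rewrite divr_gt0.
  have [c hc ca] := ha _ e3; have [d d0 hd] := hc r _ e3; exists d => // r' /hd h.
  have := nm_dist (gamma (expi r') c) (gamma (expi r') a) (gamma (expi r) a).
  have := nm_dist (gamma (expi r) c) (gamma (expi r') c) (gamma (expi r) a).
  rewrite -(linearB (gamma (expi r'))) -(linearB (gamma (expi r))).
  have := gauge_contraction r' (a - c).
  have := gauge_contraction r (c - a); rewrite nm_distC; lra.
- move=> l m x y; set t := _ ** _; have ht := gauge_degree_mono x y.
  rewrite -/t in ht; move=> r e e0.
  have M0 : 0 < nm t + 1 by rewrite ltr_wpDl // nm_ge0.
  have [d d0 hd] := @ek_ccont R (l%:Z - m%:Z) r _ (divr_gt0 e0 M0).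
  exists d => // r' /hd h; rewrite !ht -scalerBl nmZ.
  move: h; rewrite ltr_pdivlMr //; apply: le_lt_trans.
  by rewrite ler_wpM2l ?nm_ge0 // lerDl.
Qed.

End Gauge.
End Toeplitz.

(** * KMS states *)

Section Analytic.
Variables (R : realType) (B : cstarAlgType R).
Local Open Scope complex_scope.

Lemma entire_scale (f : R[i] -> R[i]) (v : B) : cdiff f -> entire (fun w => f w *: v).
Proof.
move=> df z; have [d hd] := df z; apply/cvg_ex; exists (d *: v).
apply/cvgrPdist_lt => _ /posC[e e0 ->].
have M0 : 0 < nm v + 1 by rewrite ltr_wpDl // nm_ge0.
have e2 : 0 < e / 2 / (nm v + 1) by rewrite !divr_gt0.
have [r r0 hr] := hd _ e2.
have r0' : 0 < r%:C :> R[i] by rewrite ltcR.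
apply/nbhs_ballP; exists (r%:C) => // h /ballE; rewrite sub0r nmN => /hr h1 /= h0.
rewrite nmE ltcR [h *: _]mulr1 [h + z]addrC -scalerBl scalerA -scalerBl nmZ.
have nh : 0 < nm h.
  by rewrite lt_neqAle nm_ge0 andbT eq_sym; apply/eqP => /nm0_eq0 /eqP; rewrite (negbTE h0).
have e3 : nm h * nm (d - h^-1 * (f (z + h) - f z)) <= nm h * (e / 2 / (nm v + 1)).
  rewrite [X in _ <= X]mulrC; apply: le_trans h1; rewrite -nmM mulrBr mulrA mulfV // mul1r.
  by rewrite nm_distC.
rewrite ler_pM2l // in e3.
have := ler_wpM2r (nm_ge0 v) e3.
have : e / 2 / (nm v + 1) * nm v <= e / 2.
  by rewrite mulrAC ler_pdivrMr // ler_wpM2l ?lerDl // ltW // divr_gt0.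
lra.
Qed.

(** Composing with a bounded functional reduces the analysis of entire extensions to scalar
    functions. *)
Lemma entire_functional (F : R[i] -> B) (rho : B -> R[i]) : entire F ->
  bounded_additive rho -> (forall k a, rho (k *: a) = k * rho a) ->
  cdiff (fun w => rho (F w)).
Proof.
move=> hF brho rhoZ z; have [M M0 hM] := bounded_pos brho; case: brho => rhoB _.
have := hF z; rewrite /derivable => /cvg_ex[d hd].
exists (rho d) => e e0.
have e0' : 0 < (e / M)%:C :> R[i] by rewrite ltcR divr_gt0.
move/cvgrPdist_lt : hd => /(_ _ e0') /nbhs_ballP[_ /posC[r r0 ->] hr].
exists r => // h hh; have [->|h0] := eqVneq h 0.
  by rewrite addr0 subrr mul0r subrr !nm0 mulr0.
have := hr h; move=> /(_ _ h0); rewrite /= => {}hr.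
have : nm (d - h^-1 *: (F (h *: 1 + z) - F z)) < e / M.
  by rewrite -ltcR -nmE; apply: hr; apply/ballE; rewrite sub0r nmN.
rewrite [h *: 1]mulr1 [h + z]addrC => /ltW h1.
have -> : rho (F (z + h)) - rho (F z) - h * rho d =
    - (h * rho (d - h^-1 *: (F (z + h) - F z))).
  by rewrite rhoB rhoZ rhoB mulrBr mulrA mulfV // mul1r opprB.
rewrite nmN nmM mulrC; apply: ler_wpM2r; first exact: nm_ge0.
by apply: (le_trans (hM _)); rewrite -ler_pdivlMl // mulrC.
Qed.

End Analytic.

(** * Orthogonality of exponentials *)

Section Integrals.
Variable R : realType.
Local Open Scope complex_scope.

(** Moving the path to height 1 multiplies the integral by $e^{-k}\ne 1$ and, by Cauchy's theorem,
    does not change it. *)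
Lemma cint_ek (k : int) : k != 0 -> cint (@ek R k) (- pi) pi = 0.
Proof.
move=> k0; have p2 := pi_ge2 R.
have := @cauchy_shift R _ (- pi) pi 1 (@Eexp_diff R k) ltac:(lra) ltac:(lra) _.
have -> : cint (fun x : R => Eexp k (x +i* 0)) (- pi) pi = cint (ek k) (- pi) pi.
  by apply: eq_cint => x; rewrite ek_Eexp.
have -> : cint (fun x : R => Eexp k (x +i* 1)) (- pi) pi =
    (expR (- k%:~R))%:C * cint (ek k) (- pi) pi.
  rewrite -cintZ; last exact: ek_ccont.
  by apply: eq_cint => x; rewrite Eexp_reim mulr1 mulrC.
move=> h; have /eqP : (1 - (expR (- k%:~R))%:C) * cint (@ek R k) (- pi) pi = 0.
  rewrite mulrBl mul1r [X in X - _]h ?subrr // => y.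
  have -> : (pi : R) +i* y = (- pi + pi *+ 2) +i* y.
    by congr (_ +i* _); rewrite mulr2n; ring.
  by rewrite Eexp_period.
rewrite mulf_eq0 => /orP[|/eqP //]; rewrite subr_eq0 => /eqP e1.
have /expR_inj/eqP : expR (- k%:~R) = expR 0 :> R by rewrite expR0; case: e1.
by rewrite oppr_eq0 intr_eq0 (negbTE k0).
Qed.

End Integrals.

Section KMS.
Variables (R : realType) (A : cstarAlgType R) (X : corrType A).
Variables (XX : tensor_powers X) (T : cstarAlgType R).
Variables (psi : {linear X -> T}) (pi : {linear A -> T}).
Variable Psi : forall m : nat, {linear tpow XX m -> T}.
Variables (gamma : R[i] -> {linear T -> T}) (beta : R) (phi : {scalar T}).
Hypothesis hPsi : is_induced_rep psi pi Psi.
Hypothesis hgamma : is_gauge_action psi pi gamma.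
Hypothesis hgen : generates (range psi `|` range pi).
Hypothesis hphi : is_state phi.
Implicit Types (s t a b : T) (k : int).
Local Open Scope complex_scope.

Lemma state_bounded : bounded_additive (phi : T -> R[i]).
Proof.
split; first exact: linearB.
by exists 1 => a; rewrite mul1r -lecR -!nmE; exact: state_bound hphi a.
Qed.

Lemma gauge_degree_entire k t : gauge_degree gamma k t ->
  entire_extension (gauge_dynamics gamma) t (fun w => Eexp k w *: t).
Proof.
move=> ht; split; first by apply: entire_scale; exact: Eexp_diff.
by move=> r; rewrite /gauge_dynamics ht ek_Eexp.
Qed.

Definition boltzmann k : R[i] := (expR (- (beta * k%:~R)))%:C.

Lemma boltzmannD j k : boltzmann (j + k) = boltzmann j * boltzmann k.
Proof. by rewrite /boltzmann intrD mulrDr opprD expRD rmorphM. Qed.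

Lemma boltzmann0 : boltzmann 0 = 1.
Proof. by rewrite /boltzmann mulr0 oppr0 expR0. Qed.

(* For a of gauge degree k, alpha_(i beta)(a) = exp (- beta k) a, so this is the
   KMS condition at a. It is multiplicative in a. *)
Definition kms_degree k a := forall b, phi (a ** b) = boltzmann k * phi (b ** a).

Lemma kms_gauge_degree k a b : is_KMS_state (gauge_dynamics gamma) beta phi ->
  gauge_degree gamma k a -> analytic (gauge_dynamics gamma) b ->
  phi (a ** b) = boltzmann k * phi (b ** a).
Proof.
move=> [_ h] /gauge_degree_entire ha hb; rewrite (h _ _ _ ha hb).
by rewrite Eexp_im cmulZr linearZ /boltzmann mulrC.
Qed.

(** * From the KMS condition to the formula *)

Section Necessity.
Hypothesis kms : is_KMS_state (gauge_dynamics gamma) beta phi.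

Lemma kms_trace : is_trace (phi \o pi).
Proof.
split=> [a|a b] /=.
  rewrite (rep_pi_mul (psi_rep hPsi)) (rep_pi_star (psi_rep hPsi)).
  exact: state_pos hphi _.
rewrite !(rep_pi_mul (psi_rep hPsi)).
rewrite (kms_gauge_degree kms (gauge_degree_pi hgamma a)) ?boltzmann0 ?mul1r //.
by eexists; exact: gauge_degree_entire (gauge_degree_pi hgamma b).
Qed.

Lemma kms_mono l m (x : tpow XX l) (y : tpow XX m) :
  phi (Psi l x ** cstar (Psi m y)) =
    boltzmann l%:Z * phi (cstar (Psi m y) ** Psi l x).
Proof.
apply: (kms_gauge_degree kms (gauge_degree_Psi hPsi hgamma x)); eexists.
exact: gauge_degree_entire (gauge_degree_star hgamma (gauge_degree_Psi hPsi hgamma y)).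
Qed.

(** Moving both factors round in turn returns the same value times $e^{-\beta(l-m)}$, which differs
    from 1 because $\beta>0$ and $l\ne m$. *)
Lemma kms_mono_orth l m (x : tpow XX l) (y : tpow XX m) : 0 < beta -> m <> l ->
  phi (Psi l x ** cstar (Psi m y)) = 0.
Proof.
move=> b0 ml.
have := kms_gauge_degree kms
  (gauge_degree_star hgamma (gauge_degree_Psi hPsi hgamma y))
  (ex_intro _ _ (gauge_degree_entire (gauge_degree_Psi hPsi hgamma x))).
rewrite kms_mono => e; apply/eqP; have /eqP : (1 - boltzmann l%:Z * boltzmann (- m%:Z)) *
  phi (cstar (Psi m y) ** Psi l x) = 0.
  by rewrite mulrBl mul1r [X in X - _]e mulrA [boltzmann (- _) * _]mulrC subrr.
rewrite !mulf_eq0 => /orP[|->]; last by rewrite orbT.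
rewrite -boltzmannD subr_eq0 => /eqP e1.
have /expR_inj/eqP : expR (- (beta * (l%:Z - m%:Z)%:~R)) = expR 0.
  by rewrite expR0; case: e1.
rewrite oppr_eq0 mulf_eq0 (gt_eqF b0) intr_eq0 subr_eq0 eqz_nat.
by move/eqP => lm; case: ml.
Qed.

End Necessity.

(** * From the formula to the KMS condition *)

Section Sufficiency.
Hypothesis orth : forall (l m : nat) (x : tpow XX l) (y : tpow XX m), m <> l ->
  phi (Psi l x ** cstar (Psi m y)) = 0.
Hypothesis diag : forall (m : nat) (x y : tpow XX m),
  phi (Psi m x ** cstar (Psi m y)) = boltzmann m%:Z * phi (pi (inner y x)).

(** Both cases in one equation, with the inner product turned back into a product in $T$: each side
    is then bounded additive in either factor and passes to closures. *)
Lemma mono_state l m (x : tpow XX l) (y : tpow XX m) :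
  phi (Psi l x ** cstar (Psi m y)) =
  (l == m)%:R * boltzmann m%:Z * phi (cstar (Psi m y) ** Psi l x).
Proof.
have [e|ne] := eqVneq l m; last by rewrite orth ?mul0r // => e; rewrite e eqxx in ne.
by subst m; rewrite mul1r diag (rep_inner (induced_rep hPsi l)).
Qed.

Lemma bounded_phi (f : T -> T) : bounded_additive f ->
  bounded_additive (fun t => phi (f t) : R[i]).
Proof. exact: bounded_comp state_bounded. Qed.

Lemma bounded_mulphi (c : R[i]) (f : T -> R[i]) : bounded_additive f ->
  bounded_additive (fun t => c * f t).
Proof.
move=> [fB [M hM]]; split; first by move=> u v; rewrite fB mulrBr.
by exists (nm c * M) => v; rewrite nmM -mulrA ler_wpM2l // nm_ge0.
Qed.

(** By approximate units such an element is a limit of monomials of degrees $m+1$ and 0, on which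
    [phi] vanishes. *)
Lemma state_cl_range m t : cl_range Psi m.+1 t -> phi t = 0.
Proof.
apply: (cl_range_ind (E := fun t => phi t = 0)) => [|w].
  exact: lim_closed_preim state_bounded (@lim_closed0 _ _).
apply: (rep_approx_lim (induced_rep hPsi m.+1) (E := fun t => phi t = 0)).
  exact: lim_closed_preim state_bounded (@lim_closed0 _ _).
by move=> c; rewrite (Psi_pi_star hPsi) orth.
Qed.

Lemma state_cl_range_star m t : cl_range Psi m.+1 t -> phi (cstar t) = 0.
Proof.
have cE : lim_closed (fun t => phi (cstar t) = 0).
  exact: lim_closed_preim (bounded_phi (bounded_cstar T)) (@lim_closed0 _ _).
apply: (cl_range_ind cE) => w; apply: (rep_approx_lim (induced_rep hPsi m.+1) cE).
by move=> c; rewrite (pi_star_Psi hPsi) orth.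
Qed.

(** Needed because removing a leading factor with $\psi(z)^*$ yields only elements of [cl_range]. *)
Lemma mono_state_cl l m t (y : tpow XX m) : cl_range Psi l t ->
  phi (t ** cstar (Psi m y)) =
  (l == m)%:R * boltzmann m%:Z * phi (cstar (Psi m y) ** t).
Proof.
pose E t := phi (t ** cstar (Psi m y)) =
  (l == m)%:R * boltzmann m%:Z * phi (cstar (Psi m y) ** t).
apply: (@cl_range_ind _ _ _ _ _ Psi l E) => [|w]; last exact: mono_state.
apply: lim_closed_eq; first exact: bounded_phi (bounded_cmulr _).
exact: bounded_mulphi (bounded_phi (bounded_cmull _)).
Qed.

Lemma mono_state_cl_star l m t (x : tpow XX l) : cl_range Psi m t ->
  phi (Psi l x ** cstar t) =
  (l == m)%:R * boltzmann m%:Z * phi (cstar t ** Psi l x).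
Proof.
pose E t := phi (Psi l x ** cstar t) =
  (l == m)%:R * boltzmann m%:Z * phi (cstar t ** Psi l x).
apply: (@cl_range_ind _ _ _ _ _ Psi m E) => [|w]; last exact: mono_state.
have bs := bounded_cstar T; apply: lim_closed_eq.
  exact: bounded_phi (bounded_comp (bounded_cmull _) bs).
exact: bounded_mulphi (bounded_phi (bounded_comp (bounded_cmulr _) bs)).
Qed.

Lemma kms_degree_mono k a : (forall l m (x : tpow XX l) (y : tpow XX m),
    phi (a ** (Psi l x ** cstar (Psi m y))) =
    boltzmann k * phi (Psi l x ** cstar (Psi m y) ** a)) -> kms_degree k a.
Proof.
move=> h; apply: (mono_ind hPsi hgen) => [|b c hb hc||//].
- by rewrite cmul0l cmul0r linear0 mulr0.
- by rewrite cmulDl cmulDr !linearD hb hc mulrDr.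
- apply: lim_closed_eq; first exact: bounded_phi (bounded_cmull _).
  exact: bounded_mulphi (bounded_phi (bounded_cmulr _)).
Qed.

Lemma kms_degree_lim k : lim_closed (kms_degree k).
Proof.
apply: lim_closed_forall => b; apply: lim_closed_eq.
  exact: bounded_phi (bounded_cmulr _).
exact: bounded_mulphi (bounded_phi (bounded_cmull _)).
Qed.

Lemma kms_degreeM j k a b : kms_degree j a -> kms_degree k b ->
  kms_degree (j + k) (a ** b).
Proof.
move=> ha hb c; rewrite -cmulA ha -cmulA hb boltzmannD mulrA -cmulA.
by [].
Qed.

(** The left action absorbs $\pi(a)$ into $x$ on one side and, through $a^*$, into $y$ on the
    other. *)
Lemma kms_degree_pi (a : A) : kms_degree 0 (pi a).
Proof.
apply: kms_degree_mono => l m x y; rewrite boltzmann0 mul1r cmulA -(cmulA (Psi l x)).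
have -> : cstar (Psi m y) ** pi a = cstar (Psi m (lact (cstar a) y)).
  rewrite (rep_lact (induced_rep hPsi m)) cstarM (rep_pi_star (psi_rep hPsi)).
  by rewrite cstarK.
rewrite -(rep_lact (induced_rep hPsi l)) !mono_state; congr (_ * phi _).
rewrite !(rep_lact (induced_rep hPsi _)) cstarM (rep_pi_star (psi_rep hPsi)).
by rewrite cstarK cmulA.
Qed.

(** $\psi(z)$ raises $p$ to $p+1$ when it stands in front and lowers $q$ to $q-1$ when it follows
    $\psi^q(v)^*$. Both sides reduce to $\phi(\psi^q(v)^*\psi(z)\psi^p(u))$, with equal indicators
    $p+1=q$ and weights that match by $e^{-\beta q}=e^{-\beta}e^{-\beta(q-1)}$. For $q=0$ both sides
    vanish. *)
Lemma kms_degree_psi z : kms_degree 1 (psi z).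
Proof.
apply: kms_degree_mono => p q u v; rewrite cmulA -(cmulA (Psi p u)).
have [w ew] := psi_Psi hPsi z u; rewrite ew mono_state -ew.
case: q v => [|q] v.
  rewrite mul0r mul0r (induced0 hPsi) -(rep_pi_star (psi_rep hPsi)).
  by rewrite -(rep_lact (psi_rep hPsi)) (state_cl_range (Psi_psi hPsi u _)) mulr0.
have es : cstar (Psi q.+1 v) ** psi z = cstar (cstar (psi z) ** Psi q.+1 v).
  by rewrite cstarM cstarK.
rewrite es (mono_state_cl_star _ (psi_star_Psi hPsi z v)) -es.
by rewrite intS boltzmannD eqSS cmulA !mulrA [boltzmann 1 * _]mulrC.
Qed.

(** The mirror image: now $p$ drops by one or $q$ rises by one, and $p=0$ is the vanishing case. *)
Lemma kms_degree_psi_star z : kms_degree (- 1) (cstar (psi z)).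
Proof.
apply: kms_degree_mono => p q u v; rewrite cmulA -(cmulA (Psi p u)).
have [w ew] := psi_Psi hPsi z v.
have es : cstar (Psi q v) ** cstar (psi z) = cstar (Psi q.+1 w).
  by rewrite -cstarM ew.
rewrite es mono_state -es.
case: p u => [|p] u.
  rewrite mul0r mul0r mulr0.
  have -> : cstar (psi z) ** Psi 0%N u ** cstar (Psi q v) =
      cstar (Psi q v ** psi (lact (cstar (u : A)) z)).
    rewrite (rep_lact (psi_rep hPsi)) (rep_pi_star (psi_rep hPsi)) !cstarM.
    by rewrite cstarK (induced0 hPsi).
  exact: state_cl_range_star (Psi_psi hPsi v _).
rewrite (mono_state_cl _ (psi_star_Psi hPsi z u)) eqSS cmulA.
have -> : boltzmann q%:Z = boltzmann (- 1) * boltzmann q.+1%:Z.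
  by rewrite -boltzmannD intS addKr.
by rewrite !mulrA [_ * boltzmann (- 1)]mulrC.
Qed.

Lemma kms_degree0 k : kms_degree k 0.
Proof. by move=> b; rewrite cmul0l cmul0r linear0 mulr0. Qed.

Lemma kms_degreeD k a b : kms_degree k a -> kms_degree k b -> kms_degree k (a + b).
Proof. by move=> ha hb c; rewrite cmulDl cmulDr !linearD ha hb mulrDr. Qed.

Lemma kms_degree_Psi m (u : tpow XX m) : kms_degree m%:Z (Psi m u).
Proof.
elim: m u => [|m IHm] u; first by rewrite (induced0 hPsi); exact: kms_degree_pi.
case: m u IHm => [|m] u IHm; first by rewrite (induced1 hPsi); exact: kms_degree_psi.
pattern u; apply: tpow_ind => {u}.
- by rewrite linear0; exact: kms_degree0.
- by move=> u v hu hv; rewrite linearD; exact: kms_degreeD.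
- by apply: lim_closed_preim (Psi_bounded hPsi _) _; exact: kms_degree_lim.
- move=> x xi; rewrite (induced_tcons hPsi) intS.
  by apply: kms_degreeM; [exact: kms_degree_psi | exact: IHm].
Qed.

Lemma kms_degree_Psi_star m (u : tpow XX m) : kms_degree (- m%:Z) (cstar (Psi m u)).
Proof.
elim: m u => [|m IHm] u.
  by rewrite (induced0 hPsi) -(rep_pi_star (psi_rep hPsi)); exact: kms_degree_pi.
case: m u IHm => [|m] u IHm; first by rewrite (induced1 hPsi); exact: kms_degree_psi_star.
pattern u; apply: tpow_ind => {u}.
- by rewrite linear0 cstar0; exact: kms_degree0.
- by move=> u v hu hv; rewrite linearD cstarD; exact: kms_degreeD.
- have cE := lim_closed_preim (bounded_cstar T) (@kms_degree_lim (- m.+2%:Z)).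
  exact: lim_closed_preim (Psi_bounded hPsi m.+2) cE.
- move=> x xi; rewrite (induced_tcons hPsi) cstarM intS opprD addrC.
  by apply: kms_degreeM; [exact: IHm | exact: kms_degree_psi_star].
Qed.

Lemma state_orbit_ccont (f : T -> T) a : bounded_additive f ->
  ccont (fun r : R => phi (f (gamma (expi r) a)) : R[i]).
Proof.
move=> bf r e e0; have bpf := bounded_phi bf; have [M M0 hM] := bounded_pos bpf.
case: bpf => pB _.
have [d d0 hd] := gauge_continuous hPsi hgamma hgen a r (divr_gt0 e0 M0).
exists d => // r' /hd h; rewrite -pB (le_lt_trans (hM _)) // mulrC.
by rewrite -ltr_pdivlMr.
Qed.

(** Integrated against $e^{ikr}$ and without normalisation, so an element of degree $n$ contributes
    for $k=-n$ only. The map [f] will be multiplication by $b$ on one side; [pi] names the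
    homomorphism, hence [trigo.pi] for the number. *)
Definition orbit_coef (f : T -> T) k a : R[i] :=
  cint (fun r : R => phi (f (gamma (expi r) a)) * ek k r) (- trigo.pi) trigo.pi.

Lemma orbit_coef_bounded (f : T -> T) k : bounded_additive f ->
  bounded_additive (orbit_coef f k).
Proof.
move=> bf; have bpf := bounded_phi bf; have [M M0 hM] := bounded_pos bpf.
have ck := @ek_ccont R k; case: bpf => pB _.
have cf a : ccont (fun r : R => phi (f (gamma (expi r) a)) * ek k r).
  by apply: ccontM => //; exact: state_orbit_ccont.
split=> [a b|].
  rewrite /orbit_coef -cintB //; apply: eq_cint => r.
  by rewrite linearB pB mulrBl.
have p2 := pi_ge2 R.
(* The 2 of [cint_bound] times the length $2\pi$ times the bound of $\phi\circ f$. *)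
exists (4 * trigo.pi * M) => a.
have := @cint_bound R (fun r : R => phi (f (gamma (expi r) a)) * ek k r)
  (- trigo.pi) trigo.pi (M * nm a).
rewrite -/(orbit_coef f k a) => /(_ ltac:(lra) (cf a)) h.
have : nm (orbit_coef f k a) <= 2 * (M * nm a) * (trigo.pi - - trigo.pi).
  apply: h => r _; rewrite nmM.
  have -> : nm (ek k r : R[i]) = 1 by rewrite /nm expi_norm.
  rewrite mulr1 (le_trans (hM _)) // ler_pM2l //.
  exact: gauge_contraction hgamma _ _.
by move/le_trans; apply; rewrite le_eqVlt; apply/orP; left; apply/eqP; ring.
Qed.

Lemma orbit_coef_kms k a b :
  orbit_coef (fun t => t ** b) k a =
    (expR (k%:~R * beta))%:C * orbit_coef (fun t => b ** t) k a.
Proof.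
have b1 := orbit_coef_bounded k (bounded_cmulr b).
have b2 := orbit_coef_bounded k (bounded_cmull b).
pattern a; apply: (mono_ind hPsi hgen) => {a}.
- case: b1 b2 => [h1 _] [h2 _]; have := h1 0 0; have := h2 0 0.
  by rewrite !subrr => -> ->; rewrite mulr0.
- move=> a c ha hc; case: b1 b2 => [h1 _] [h2 _].
  have := h1 a (- c); have := h2 a (- c); have := h1 0 c; have := h2 0 c.
  have := h1 0 0; have := h2 0 0.
  by rewrite !subrr !sub0r !opprK => -> ->; rewrite !sub0r => -> -> -> ->;
    rewrite !opprK mulrDr ha hc.
- exact: lim_closed_eq b1 (bounded_mulphi _ b2).
- move=> l m x y; set t := _ ** _; set n : int := l%:Z - m%:Z.
  have dt : gauge_degree gamma n t by exact: (gauge_degree_mono hPsi hgamma).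
  have kt : kms_degree n t.
    by apply: kms_degreeM; [exact: kms_degree_Psi | exact: kms_degree_Psi_star].
  have coefE f : (forall c s, f (c *: s) = c *: f s) -> orbit_coef f k t =
      phi (f t) * cint (@ek R (n + k)) (- trigo.pi) trigo.pi.
    move=> fZ; rewrite /orbit_coef -cintZ; last exact: ek_ccont.
    by apply: eq_cint => r; rewrite dt fZ linearZ /= ekD mulrA [phi _ * _]mulrC.
  rewrite !coefE; [|by move=> c s; rewrite cmulZr|by move=> c s; rewrite cmulZl].
  (* In the one surviving case $k=-n$ the weight $e^{-\beta n}$ is $e^{k\beta}$. *)
  have [nk|nk] := eqVneq (n + k) 0; last by rewrite cint_ek // !mulr0.
  rewrite mulrA kt /boltzmann; congr (_ * _ * _); congr (expR _)%:C.
  have -> : k = - n by apply/eqP; rewrite -addr_eq0 addrC nk.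
  by rewrite mulrNz mulNr mulrC.
Qed.

Lemma kms_of_monomials : 0 < beta -> is_KMS_state (gauge_dynamics gamma) beta phi.
Proof.
move=> b0; split=> // a b F [eF Fa] _.
have bb := bounded_cmull b.
have bQ := bounded_phi bb.
have dQ : cdiff (fun w => phi (b ** F w) : R[i]).
  by apply: (entire_functional eF bQ) => k c; rewrite cmulZr linearZ.
have := @fourier_shift R (fun r : R => phi (gamma (expi r) a ** b))
  (fun w => phi (b ** F w)) beta (ltW b0) _ dQ.
rewrite expi0 (circle1 (gauge_action hgamma)); apply.
- exact: state_orbit_ccont (bounded_cmulr b).
- move=> t; rewrite !Fa /gauge_dynamics; congr (phi (b ** gamma _ a)).
  by have := expi_int_period R 1; rewrite mul1r expiD => ->; rewrite mulr1.
- move=> k; rewrite -[LHS]/(orbit_coef (fun t => t ** b) k a) orbit_coef_kms.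
  by congr (_ * _); apply: eq_cint => r; rewrite Fa.
Qed.

End Sufficiency.
End KMS.

Theorem proposition3p1 (R : realType) (A : cstarAlgType R) (X : corrType A)
    (XX : tensor_powers X) (T : cstarAlgType R)
    (psi : {linear X -> T}) (pi : {linear A -> T})
    (Psi : forall m : nat, {linear tpow XX m -> T})
    (gamma : R[i] -> {linear T -> T}) (beta : R) (phi : {scalar T})
    (hT : is_toeplitz psi pi)
    (hPsi : is_induced_rep psi pi Psi)
    (hgamma : is_gauge_action psi pi gamma)
    (hbeta : 0 < beta)
    (hphi : is_state phi) :
  is_KMS_state (gauge_dynamics gamma) beta phi <->
  is_trace (phi \o pi) /\
  (forall (l m : nat) (x : tpow XX l) (y : tpow XX m), m <> l ->
     phi (Psi l x ** cstar (Psi m y)) = 0) /\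
  (forall (m : nat) (x y : tpow XX m),
     phi (Psi m x ** cstar (Psi m y)) =
       ((expR (- (beta * m%:R)))%:C)%C * phi (pi (inner y x))).
Proof.
have hgen := toeplitz_gen hT; split=> [kms|[_ [orth diag]]].
  split; first exact: kms_trace hPsi hgamma hphi kms.
  split=> [l m x y ml|m x y]; first exact: (kms_mono_orth hPsi hgamma kms).
  by rewrite (kms_mono hPsi hgamma kms) (rep_inner (induced_rep hPsi m)).
exact: (kms_of_monomials hPsi hgamma hgen hphi orth diag).
Qed.
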